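(* Let $\Delta,\Lambda\in\mathbb C$. Any proper singular vector in the $K(1,2)_+$-module $M(\Delta,\Lambda)$ is a scalar multiple of one of the following vectors: (i) $G^+_{-\frac12}v_{\Delta,\Lambda}$, in which case $2\Delta-\Lambda=0$; in the particular case $\Delta=-\frac12$ and $\Lambda=-1$ one has in addition $G^-_{-\frac12}G^+_{-\frac12}v_{\Delta,\Lambda}$; (ii) $G^-_{-\frac12}v_{\Delta,\Lambda}$, in which case $2\Delta+\Lambda=0$; in the particular case $\Delta=-\frac12$ and $\Lambda=1$ one has in addition $G^+_{-\frac12}G^-_{-\frac12}v_{\Delta,\Lambda}$.
   Context: $\mathfrak g=K(1,2)_+$ is the complex Lie superalgebra with basis: even elements $L_m$ ($m\in\mathbb Z$, $m\ge-1$), $J_n$ ($n\in\mathbb Z$, $n\ge0$), odd elements $G^{\pm}_r$ ($r\in\frac12+\mathbb Z$, $r\ge-\frac12$), and nonzero brackets $[L_m,L_n]=(m-n)L_{m+n}$, $[L_m,G^\pm_r]=(\frac m2-r)G^\pm_{m+r}$, $[L_m,J_n]=-nJ_{m+n}$, $[J_m,G^\pm_r]=\pm G^\pm_{m+r}$, $[G^+_r,G^-_s]=2L_{r+s}+(r-s)J_{r+s}$. Let $\mathfrak g_j$ be the span of the basis elements with index $j$, so $\mathfrak g=\bigoplus_{j\ge-1}\mathfrak g_j$, $j\in\frac12\mathbb Z$. Put $\mathfrak L_0=\bigoplus_{j\ge0}\mathfrak g_j$. For $\Delta,\Lambda\in\mathbb C$ let $\mathbb Cv_{\Delta,\Lambda}$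 be the one-dimensional $\mathfrak L_0$-module with $L_0v_{\Delta,\Lambda}=\Delta v_{\Delta,\Lambda}$, $J_0v_{\Delta,\Lambda}=\Lambda v_{\Delta,\Lambda}$, $\mathfrak g_jv_{\Delta,\Lambda}=0$ for $j>0$, and let $M(\Delta,\Lambda)=U(\mathfrak g)\otimes_{U(\mathfrak L_0)}\mathbb Cv_{\Delta,\Lambda}$. A nonzero $(L_0,J_0)$-weight vector (simultaneous eigenvector) $v\in M(\Delta,\Lambda)$ is singular if $\mathfrak g_jv=0$ for all $j>0$; it is a proper singular vector if moreover it is not a scalar multiple of $v_{\Delta,\Lambda}$. *)

(* Defs.v *)
From HB Require Import structures.
From mathcomp Require Import all_boot all_order all_algebra generic_quotient ring_quotient.
From mathcomp Require Import boolp reals complex.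
From mathcomp Require Import finmap monalg.

Set Implicit Arguments.
Unset Strict Implicit.
Unset Printing Implicit Defensive.

Import GRing.Theory.

Local Open Scope ring_scope.
Local Open Scope quotient_scope.

Section LmodQuotient.
Variables (A : pzRingType) (V : lmodType A) (S : V -> Prop).

Inductive submod_span : V -> Prop :=
| submod_span0 : submod_span 0
| submod_spanP a x y : S x -> submod_span y -> submod_span (a *: x + y).

Lemma submod_spanD x y : submod_span x -> submod_span y -> submod_span (x + y).
Proof.
move=> hx hy; elim: hx => [|a u z Su _ ih]; first by rewrite add0r.
by rewrite -addrA; apply: submod_spanP.
Qed.

Lemma submod_spanZ a x : submod_span x -> submod_span (a *: x).
Proof.
elim=> [|b u z Su _ ih]; first by rewrite scaler0; exact: submod_span0.
by rewrite scalerDr scalerA; apply: submod_spanP.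
Qed.

Definition submod_pred : {pred V} := fun x => `[< submod_span x >].

Lemma submod_pred_zmod_closed : zmod_closed submod_pred.
Proof.
split=> [|x y /asboolP hx /asboolP hy]; apply/asboolP.
  exact: submod_span0.
by apply: submod_spanD => //; rewrite -scaleN1r; apply: submod_spanZ.
Qed.

HB.instance Definition _ := GRing.isZmodClosed.Build V submod_pred
  submod_pred_zmod_closed.

Definition lmod_quot := Quotient.quot submod_pred.

HB.instance Definition _ := EqQuotient.on lmod_quot.
HB.instance Definition _ := GRing.Zmodule.on lmod_quot.

Definition lmod_pi (x : V) : lmod_quot := \pi_(lmod_quot) x.

Lemma lmod_piP x y : lmod_pi x = lmod_pi y <-> submod_span (x - y).
Proof.
split=> [/eqP | h]; last apply/eqP.
  by rewrite -Quotient.idealrBE => /asboolP.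
by rewrite -Quotient.idealrBE; apply/asboolP.
Qed.

Definition lmod_quot_scale (a : A) (q : lmod_quot) : lmod_quot :=
  lmod_pi (a *: repr q).

Lemma lmod_pi_repr q : lmod_pi (repr q) = q.
Proof. exact: reprK. Qed.

Lemma lmod_pi_scale a x : lmod_quot_scale a (lmod_pi x) = lmod_pi (a *: x).
Proof.
apply/lmod_piP; rewrite -scalerBr; apply: submod_spanZ.
by apply/lmod_piP; rewrite lmod_pi_repr.
Qed.

Lemma lmod_piD : {morph lmod_pi : x y / x + y}.
Proof. by move=> x y; rewrite /lmod_pi raddfD. Qed.

Lemma lmod_quot_scaleA a b q :
  lmod_quot_scale a (lmod_quot_scale b q) = lmod_quot_scale (a * b) q.
Proof. by rewrite -[q]lmod_pi_repr !lmod_pi_scale scalerA. Qed.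

Lemma lmod_quot_scale1 : left_id 1 lmod_quot_scale.
Proof. by move=> q; rewrite -[q]lmod_pi_repr lmod_pi_scale scale1r. Qed.

Lemma lmod_quot_scaleDr : right_distributive lmod_quot_scale +%R.
Proof.
move=> a p q; rewrite -[p]lmod_pi_repr -[q]lmod_pi_repr.
by rewrite -lmod_piD !lmod_pi_scale -lmod_piD scalerDr.
Qed.

Lemma lmod_quot_scaleDl q : {morph lmod_quot_scale^~ q : a b / a + b}.
Proof.
by move=> a b; rewrite -[q]lmod_pi_repr !lmod_pi_scale -lmod_piD scalerDl.
Qed.

HB.instance Definition _ := GRing.Zmodule_isLmodule.Build A lmod_quot
  lmod_quot_scaleA lmod_quot_scale1 lmod_quot_scaleDr lmod_quot_scaleDl.

End LmodQuotient.

Section AlgQuotient.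
Variables (K : comNzRingType) (A : lalgType K) (S : A -> Prop).

(* Two-sided. *)
Inductive ideal_span : A -> Prop :=
| ideal_span0 : ideal_span 0
| ideal_spanP a b x y : S x -> ideal_span y -> ideal_span (a * x * b + y).

Lemma ideal_spanD x y : ideal_span x -> ideal_span y -> ideal_span (x + y).
Proof.
move=> hx hy; elim: hx => [|a b u z Su _ ih]; first by rewrite add0r.
by rewrite -addrA; apply: ideal_spanP.
Qed.

Lemma ideal_spanMl a x : ideal_span x -> ideal_span (a * x).
Proof.
elim=> [|b c u z Su _ ih]; first by rewrite mulr0; exact: ideal_span0.
by rewrite mulrDr !mulrA; apply: ideal_spanP.
Qed.

Lemma ideal_spanMr a x : ideal_span x -> ideal_span (x * a).
Proof.
elim=> [|b c u z Su _ ih]; first by rewrite mul0r; exact: ideal_span0.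
by rewrite mulrDl -!mulrA mulrA; apply: ideal_spanP.
Qed.

Definition ideal_pred : {pred A} := fun x => `[< ideal_span x >].

Lemma ideal_pred_zmod_closed : zmod_closed ideal_pred.
Proof.
split=> [|x y /asboolP hx /asboolP hy]; apply/asboolP.
  exact: ideal_span0.
by apply: ideal_spanD => //; rewrite -mulN1r; apply: ideal_spanMl.
Qed.

HB.instance Definition _ := GRing.isZmodClosed.Build A ideal_pred
  ideal_pred_zmod_closed.

Definition alg_quot := Quotient.quot ideal_pred.

HB.instance Definition _ := EqQuotient.on alg_quot.
HB.instance Definition _ := GRing.Zmodule.on alg_quot.

Definition alg_pi (x : A) : alg_quot := \pi_(alg_quot) x.

Lemma alg_piP x y : alg_pi x = alg_pi y <-> ideal_span (x - y).
Proof.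
split=> [/eqP | h]; last apply/eqP.
  by rewrite -Quotient.idealrBE => /asboolP.
by rewrite -Quotient.idealrBE; apply/asboolP.
Qed.

Lemma alg_piD : {morph alg_pi : x y / x + y}.
Proof. by move=> x y; rewrite /alg_pi raddfD. Qed.

Lemma alg_pi0 : alg_pi 0 = 0.
Proof. by rewrite /alg_pi raddf0. Qed.

Lemma alg_pi_repr q : alg_pi (repr q) = q.
Proof. exact: reprK. Qed.

Definition alg_quot_mul (p q : alg_quot) : alg_quot := alg_pi (repr p * repr q).

Lemma alg_piM x y : alg_quot_mul (alg_pi x) (alg_pi y) = alg_pi (x * y).
Proof.
have eP z : ideal_span (repr (alg_pi z) - z).
  by apply/alg_piP; rewrite alg_pi_repr.
apply/alg_piP.
rewrite -(subrKA (x * repr (alg_pi y))) -mulrBl -mulrBr.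
by apply: ideal_spanD; [apply: ideal_spanMr | apply: ideal_spanMl].
Qed.

Lemma alg_quot_mulA : associative alg_quot_mul.
Proof.
move=> p q r; rewrite -[p]alg_pi_repr -[q]alg_pi_repr -[r]alg_pi_repr.
by rewrite !alg_piM mulrA.
Qed.

Lemma alg_quot_mul1r : left_id (alg_pi 1) alg_quot_mul.
Proof. by move=> p; rewrite -[p]alg_pi_repr alg_piM mul1r. Qed.

Lemma alg_quot_mulr1 : right_id (alg_pi 1) alg_quot_mul.
Proof. by move=> p; rewrite -[p]alg_pi_repr alg_piM mulr1. Qed.

Lemma alg_quot_mulDl : left_distributive alg_quot_mul +%R.
Proof.
move=> p q r; rewrite -[p]alg_pi_repr -[q]alg_pi_repr -[r]alg_pi_repr.
by rewrite -alg_piD !alg_piM -alg_piD mulrDl.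
Qed.

Lemma alg_quot_mulDr : right_distributive alg_quot_mul +%R.
Proof.
move=> p q r; rewrite -[p]alg_pi_repr -[q]alg_pi_repr -[r]alg_pi_repr.
by rewrite -alg_piD !alg_piM -alg_piD mulrDr.
Qed.

HB.instance Definition _ := GRing.Zmodule_isPzRing.Build alg_quot
  alg_quot_mulA alg_quot_mul1r alg_quot_mulr1 alg_quot_mulDl alg_quot_mulDr.

Definition alg_quot_scale (c : K) (q : alg_quot) : alg_quot :=
  alg_pi (c%:A) * q.

Lemma alg_pi_scale c x : alg_quot_scale c (alg_pi x) = alg_pi (c *: x).
Proof. by rewrite /alg_quot_scale [LHS]alg_piM mulr_algl. Qed.

Lemma alg_quot_scaleA a b q :
  alg_quot_scale a (alg_quot_scale b q) = alg_quot_scale (a * b) q.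
Proof. by rewrite -[q]alg_pi_repr !alg_pi_scale scalerA. Qed.

Lemma alg_quot_scale1 : left_id 1 alg_quot_scale.
Proof. by move=> q; rewrite -[q]alg_pi_repr alg_pi_scale scale1r. Qed.

Lemma alg_quot_scaleDr : right_distributive alg_quot_scale +%R.
Proof. by move=> a p q; rewrite /alg_quot_scale mulrDr. Qed.

Lemma alg_quot_scaleDl q : {morph alg_quot_scale^~ q : a b / a + b}.
Proof. by move=> a b; rewrite /alg_quot_scale scalerDl alg_piD mulrDl. Qed.

HB.instance Definition _ := GRing.Zmodule_isLmodule.Build K alg_quot
  alg_quot_scaleA alg_quot_scale1 alg_quot_scaleDr alg_quot_scaleDl.

Lemma alg_quot_scaleAl (c : K) (p q : alg_quot) : c *: (p * q) = (c *: p) * q.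
Proof. exact: mulrA. Qed.

Lemma alg_pi_is_zmod_morphism : zmod_morphism alg_pi.
Proof. by move=> x y; rewrite /alg_pi raddfB. Qed.

HB.instance Definition _ := GRing.isZmodMorphism.Build A alg_quot alg_pi
  alg_pi_is_zmod_morphism.

Lemma alg_pi_is_monoid_morphism : monoid_morphism alg_pi.
Proof. by split=> // x y; rewrite -alg_piM. Qed.

HB.instance Definition _ := GRing.isMonoidMorphism.Build A alg_quot alg_pi
  alg_pi_is_monoid_morphism.

Lemma alg_pi_is_scalable : scalable alg_pi.
Proof. by move=> c x; rewrite -alg_pi_scale. Qed.

HB.instance Definition _ := GRing.isScalable.Build K A alg_quot *:%R alg_pi
  alg_pi_is_scalable.

End AlgQuotient.

(* A Lie superalgebra over K is presented by a homogeneous basis I, the parity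
   of the basis elements (true = odd) and the brackets of basis elements. *)
Section Enveloping.
Variables (K : comNzRingType) (I : choiceType).
Variables (par : I -> bool) (br : I -> I -> {malg K[I]}).

(* The free algebra on I is the tensor algebra of the free module {malg K[I]}. *)
Local Notation tensor_alg := {malg K[{fmonom I}]}.

Definition tgen (x : I) : tensor_alg := << fmu x >>.

Definition tlin (z : {malg K[I]}) : tensor_alg :=
  \sum_(x <- msupp z) z@_x *: tgen x.

Inductive env_rel : tensor_alg -> Prop :=
| EnvRel x y : env_rel
    (tgen x * tgen y - (-1) ^+ (par x && par y) * (tgen y * tgen x)
     - tlin (br x y)).

Definition env := alg_quot env_rel.

HB.instance Definition _ := GRing.PzRing.on env.
HB.instance Definition _ := GRing.Lmodule.on env.

Definition env_gen (x : I) : env := alg_pi env_rel (tgen x).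

Lemma mcoeff1_tgen x : (tgen x)@_mone = 0.
Proof. by rewrite /tgen mcoeffU (negbTE (negbT (fm1_eq1 x))). Qed.

Lemma mcoeff1_env_rel z : ideal_span env_rel z -> z@_mone = 0.
Proof.
elim=> [|a b _ y [u w] _ ih]; first by rewrite mcoeff0.
rewrite mcoeffD ih addr0 !rmorphM !rmorphB !rmorphM /= !mcoeff1_tgen.
rewrite /tlin raddf_sum /= big1 => [|i _]; last first.
  by rewrite mcoeffZ mcoeff1_tgen mulr0.
by rewrite !mulr0 !subr0 mulr0 mul0r.
Qed.

Lemma env_nontrivial : (1 : env) != 0.
Proof.
apply/eqP => h; have /alg_piP : alg_pi env_rel 1 = alg_pi env_rel 0.
  by rewrite alg_pi0.
move=> /mcoeff1_env_rel /eqP.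
by rewrite subr0 rmorph1 oner_eq0.
Qed.

HB.instance Definition _ := GRing.PzSemiRing_isNonZero.Build env env_nontrivial.
HB.instance Definition _ := GRing.Lmodule_isLalgebra.Build K env
  (@alg_quot_scaleAl _ _ env_rel).

(* Extension of scalars to U(g) of a module W over the subalgebra h of g with
   basis {x | h x}: the free U(g)-module on the symbols 1 (x) w, where
   << u *g w >> is u (x) w, modulo K-linearity in w and balancedness over U(h).
   As U(h) is generated by K and h, it suffices to balance over these. *)
Variables (h : pred I) (W : lmodType K) (act : I -> W -> W).

Inductive ind_rel : {malg env[W]} -> Prop :=
| IndAdd w w' : ind_rel (<< w + w' >> - << w >> - << w' >>)
| IndScale c w : ind_rel (<< c%:A *g w >> - << c *: w >>)
| IndAct x w : h x -> ind_rel (<< env_gen x *g w >> - << act x w >>).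

Definition ind_mod : lmodType env := lmod_quot ind_rel.

Definition ind_tensor (u : env) (w : W) : ind_mod :=
  lmod_pi ind_rel << u *g w >>.

End Enveloping.

Arguments env_gen {K I} par br x.
Arguments ind_mod {K I} par br h {W} act.
Arguments ind_tensor {K I} par br h {W} act u w.

(* kL a = L_(a-1), kJ a = J_a, kG true a = G^+_(a-1/2), kG false a = G^-_(a-1/2):
   indices are shifted so as to start from 0. *)
Inductive kbasis := kL of nat | kJ of nat | kG of bool & nat.

Definition kbasis_code (x : kbasis) : nat + nat + bool * nat :=
  match x with
  | kL a => inl (inl a) | kJ a => inl (inr a) | kG e a => inr (e, a)
  end.

Definition kbasis_decode (c : nat + nat + bool * nat) : kbasis :=
  match c with
  | inl (inl a) => kL a | inl (inr a) => kJ a | inr (e, a) => kG e a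
  end.

Lemma kbasis_codeK : cancel kbasis_code kbasis_decode.
Proof. by case. Qed.

HB.instance Definition _ := Countable.copy kbasis (can_type kbasis_codeK).

Definition kodd (x : kbasis) : bool := if x is kG _ _ then true else false.

Definition kdeg (x : kbasis) : rat :=
  match x with
  | kL a => a%:R - 1 | kJ a => a%:R | kG _ a => a%:R - 2^-1
  end.

Section K12.
Variable K : fieldType.

(* The truncated predecessors are harmless: when both shifted indices are 0 the
   coefficient of the corresponding term vanishes. *)
Definition kbr (x y : kbasis) : {malg K[kbasis]} :=
  let m : K := ratr (kdeg x) in
  let n : K := ratr (kdeg y) in
  match x, y with
  | kL a, kL b => << m - n *g kL (a + b).-1 >>
  | kL a, kJ b => << - n *g kJ (a + b).-1 >>
  | kJ a, kL b => << m *g kJ (a + b).-1 >>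
  | kL a, kG e b => << m / 2 - n *g kG e (a + b).-1 >>
  | kG e a, kL b => << m - n / 2 *g kG e (a + b).-1 >>
  | kJ _, kJ _ => 0
  | kJ a, kG e b => << (if e then 1 else - 1) *g kG e (a + b) >>
  | kG e a, kJ b => << (if e then - 1 else 1) *g kG e (a + b) >>
  | kG true a, kG false b =>
      << 2 *g kL (a + b) >> + << m - n *g kJ (a + b).-1 >>
  | kG false a, kG true b =>
      << 2 *g kL (a + b) >> + << n - m *g kJ (a + b).-1 >>
  | kG true _, kG true _ | kG false _, kG false _ => 0
  end.

Definition UK12 := env kodd kbr.

Definition kgen (x : kbasis) : UK12 := env_gen kodd kbr x.

Section Verma.
Variables Delta Lambda : K.

Definition kweight (x : kbasis) : K :=
  match x with
  | kL 1 => Delta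
  | kJ 0 => Lambda
  | _ => 0
  end.

(* The basis of the subalgebra spanned by the elements of degree >= 0. *)
Definition kL0 : pred kbasis := fun x => 0 <= kdeg x.

(* The one-dimensional module over that subalgebra is K^o, its generator being 1. *)
Definition kact (x : kbasis) (c : K^o) : K^o := kweight x *: c.

Definition verma : lmodType UK12 :=
  ind_mod kodd kbr kL0 kact.

Definition verma_v : verma := ind_tensor kodd kbr kL0 kact 1 1.

(* The elements c%:A act on the U(g)-module verma as the scalars c of K. *)
Definition singular (w : verma) : Prop :=
  [/\ w != 0,
      (exists a : K, kgen (kL 1) *: w = a%:A *: w),
      (exists b : K, kgen (kJ 0) *: w = b%:A *: w) &
      forall x, 0 < kdeg x -> kgen x *: w = 0].

Definition proper_singular (w : verma) : Prop :=
  singular w /\ ~ (exists c : K, w = c%:A *: verma_v).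

End Verma.
End K12.

(* Main.v *)
Require Import Defs.
From HB Require Import structures.
From mathcomp Require Import all_boot all_order all_algebra.
From mathcomp Require Import boolp functions reals complex.
From mathcomp Require Import generic_quotient finmap monalg.
From mathcomp Require Import ring lra zify.

(** Write L, G+, G- for L_(-1), G^+_(-1/2), G^-_(-1/2).  The elements L^k v,
    L^k G+ v, L^k G- v, L^k (G+ G- - L) v form a basis of M(Delta, Lambda).
    In this basis the eigenvalues of L_0 and J_0 separate the vectors except
    for the pairs L^n v, L^(n-1) (G+ G- - L) v.  So a singular vector is
    either a multiple of some L^n G^e v or a combination of such a pair.  In
    the first case G^(-e)_(1/2) gives n = 0 and 2 Delta = e Lambda.  In the
    second case, with coefficients x and y, n > 0, the two operators
    G^(+-)_(1/2) give x = Lambda y and n = - 2 Delta, then J_1 gives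
    Lambda^2 = n, and also Lambda = 0 unless n = 1; hence n = 1,
    Delta = - 1/2 and Lambda = 1 or - 1 ([odd_singular], [even_singular]).
    Conversely, the listed vectors are checked to be killed by all positive
    modes ([Gv_proper], [GGv_proper]).

    What needs an argument is that these elements form a basis.  They span
    because, by induction on the number of lowering operators applied to v,
    the span of all products of lowering operators is stable under g, and
    L, G+, G- satisfy (G+)^2 = (G-)^2 = 0, G+ G- + G- G+ = 2 L with L
    central among them ([all_lowered], [pbw_span]).

    They are independent because there is an explicit model.  Formally, in
    terms of the divided powers L^k / k!, the element L_(a-1) acts on
    p(L) u by a differential operator in L, that is, by the shift of the
    index k by a - 1 with coefficients polynomial in k and a.  These
    formulas make sense for all integers k, and define a representation of
    g on four-component functions of k ([series_bracket]), where the
    brackets become polynomial identities without boundary cases.  The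
    functions without coefficients at L^k for k >= 0 form a submodule
    ([restr_act]), and modulo this submodule the delta function at the
    origin satisfies the relations that define v ([vac_act]).  The
    resulting map sends the spanning vectors to multiples of distinct delta
    functions ([coords_pbw]), so a vector of M(Delta, Lambda) is determined
    by its coordinates in the model ([coords_inj]), and every statement
    about singular vectors becomes a statement about those coordinates. *)

Set Implicit Arguments.
Unset Strict Implicit.
Unset Printing Implicit Defensive.

Import Order.TTheory GRing.Theory Num.Theory.

Local Open Scope ring_scope.

(** * Modules over an enveloping algebra from operators satisfying the brackets *)

Section MalgSum.
Variables (T : choiceType) (G V : zmodType) (s : T -> {additive G -> V}).

(** The additive extension of a family of additive maps to the free module;
    linear combinations of operators, the action of the tensor algebra and the
    maps out of a free module over an enveloping algebra are all of this form. *)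
Definition malg_sum (z : {malg G[T]}) : V := \sum_(k <- msupp z) s k z@_k.

Lemma malg_sumEw (d : {fset T}) z :
  (msupp z `<=` d)%fset -> malg_sum z = \sum_(k <- d) s k z@_k.
Proof.
move=> le; apply/big_fset_incl => // k _ /mcoeff_outdom ->.
by rewrite raddf0.
Qed.

Lemma malg_sumU c k : malg_sum << c *g k >> = s k c.
Proof.
by rewrite (malg_sumEw msuppU_le) big_seq_fset1 mcoeffUU.
Qed.

Lemma malg_sum_is_zmod_morphism : zmod_morphism malg_sum.
Proof.
move=> x y; pose d := (msupp x `|` msupp y)%fset.
rewrite (malg_sumEw (msuppB_le _ _)) !(@malg_sumEw d) ?fsubsetUl ?fsubsetUr //.
rewrite -sumrB; apply: eq_bigr => k _; rewrite mcoeffB raddfB //.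
Qed.
HB.instance Definition _ :=
  GRing.isZmodMorphism.Build _ _ malg_sum malg_sum_is_zmod_morphism.
End MalgSum.

Section EnvAction.
Variables (K : comNzRingType) (I : choiceType).
Variables (par : I -> bool) (br : I -> I -> {malg K[I]}).
Variables (V : lmodType K) (rho : I -> {linear V -> V}).

Definition scale_to (v : V) (c : K) : V := c *: v.
Lemma scale_to_is_zmod_morphism v : zmod_morphism (scale_to v).
Proof. by move=> a b; rewrite /scale_to scalerBl. Qed.
HB.instance Definition _ v :=
  GRing.isZmodMorphism.Build _ _ (scale_to v) (scale_to_is_zmod_morphism v).

Definition lin_act (z : {malg K[I]}) (v : V) : V :=
  malg_sum (fun x => scale_to (rho x v)) z.

Lemma lin_actU c x v : lin_act << c *g x >> v = c *: rho x v.
Proof. exact: malg_sumU. Qed.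

Lemma lin_act0 v : lin_act 0 v = 0.
Proof. exact: raddf0. Qed.

Lemma lin_actD y z v : lin_act (y + z) v = lin_act y v + lin_act z v.
Proof. exact: raddfD. Qed.

Definition word_act (m : {fmonom I}) (v : V) : V :=
  foldr (fun x => rho x) v (fmonom_val m).

Definition tensor_act (z : {malg K[{fmonom I}]}) (v : V) : V :=
  malg_sum (fun m => scale_to (word_act m v)) z.

Lemma word_act_linear m : linear (word_act m).
Proof.
rewrite /word_act => c u v; elim: (fmonom_val m) => //= x s ->.
by rewrite linearP.
Qed.
HB.instance Definition _ m :=
  GRing.isLinear.Build K V V _ (word_act m) (word_act_linear m).

Lemma tensor_act_linear z : linear (tensor_act z).
Proof.
move=> c u v; rewrite /tensor_act /malg_sum scaler_sumr -big_split /=.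
apply: eq_bigr => m _; rewrite /scale_to word_act_linear.
by rewrite scalerDr !scalerA mulrC.
Qed.
HB.instance Definition _ z :=
  GRing.isLinear.Build K V V _ (tensor_act z) (tensor_act_linear z).

Lemma tensor_actB z z' v :
  tensor_act (z - z') v = tensor_act z v - tensor_act z' v.
Proof. exact: raddfB. Qed.

Lemma tensor_actN z v : tensor_act (- z) v = - tensor_act z v.
Proof. exact: raddfN. Qed.

Lemma tensor_actD z z' v :
  tensor_act (z + z') v = tensor_act z v + tensor_act z' v.
Proof. exact: raddfD. Qed.

Lemma tensor_act_sum (J : Type) (r : seq J) (F : J -> _) v :
  tensor_act (\sum_(i <- r) F i) v = \sum_(i <- r) tensor_act (F i) v.
Proof. exact: raddf_sum. Qed.

Lemma tensor_actU c m v : tensor_act << c *g m >> v = c *: word_act m v.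
Proof. exact: malg_sumU. Qed.

Lemma tensor_actZ c z v : tensor_act (c *: z) v = c *: tensor_act z v.
Proof.
rewrite /tensor_act (malg_sumEw _ (msuppZ_le _ _)) /malg_sum scaler_sumr.
by apply: eq_bigr => m _; rewrite mcoeffZ /scale_to scalerA.
Qed.

Lemma tensor_act1 v : tensor_act 1 v = v.
Proof.
by rewrite tensor_actU scale1r /word_act -[fmonom_val _]/(_ : seq I) fm1.
Qed.

Lemma tensor_act_gen x v : tensor_act (tgen K x) v = rho x v.
Proof. by rewrite tensor_actU scale1r /word_act fmU. Qed.

Lemma tensor_actM z z' v : tensor_act (z * z') v = tensor_act z (tensor_act z' v).
Proof.
rewrite malgME tensor_act_sum [RHS]/tensor_act /malg_sum.
apply: eq_bigr => m _; rewrite tensor_act_sum /= /scale_to.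
rewrite /tensor_act /malg_sum linear_sum scaler_sumr.
apply: eq_bigr => m' _; rewrite [LHS]tensor_actU /scale_to linearZ scalerA.
by rewrite /word_act fmM foldr_cat.
Qed.

Lemma tensor_act_tlin z v : tensor_act (tlin z) v = lin_act z v.
Proof.
rewrite tensor_act_sum; apply: eq_bigr => x _.
by rewrite tensor_actZ tensor_act_gen.
Qed.

(** The relators of the enveloping algebra act by the defect of the bracket
    relation. *)
Lemma tensor_act_supercomm (s : bool) a b z v :
  tensor_act (a * b - (-1) ^+ s * (b * a) - tlin z) v =
  tensor_act a (tensor_act b v) - (-1) ^+ s *: tensor_act b (tensor_act a v)
  - lin_act z v.
Proof.
have E : tensor_act ((-1) ^+ s * (b * a)) v =
    (-1) ^+ s *: tensor_act b (tensor_act a v).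
  rewrite -(tensor_actM b a).
  by case: s; rewrite ?mulN1r ?mul1r ?scaleN1r ?scale1r // tensor_actN.
rewrite -E -(tensor_actM a b) -(tensor_act_tlin z).
exact: (etrans (tensor_actB _ _ v) (congr1 (+%R^~ _) (tensor_actB _ _ v))).
Qed.

Hypothesis rho_bracket : forall x y v,
  rho x (rho y v) - (-1) ^+ (par x && par y) *: rho y (rho x v)
  = lin_act (br x y) v.

(** By multiplicativity of the action it suffices that the relators act by
    zero, which is the bracket relation for [rho]. *)
Lemma tensor_act_ideal z v : ideal_span (env_rel par br) z -> tensor_act z v = 0.
Proof.
elim=> [|a b _ y [s t] _ ih]; first exact: (raddf0 (malg_sum _)).
rewrite tensor_actD ih addr0 !tensor_actM.
rewrite tensor_act_supercomm !(tensor_act_gen s) !(tensor_act_gen t).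
by rewrite rho_bracket subrr linear0.
Qed.

Definition env_act (q : env par br) (v : V) : V := tensor_act (repr q) v.

Lemma env_act_pi z v : env_act (alg_pi (env_rel par br) z) v = tensor_act z v.
Proof.
apply/eqP; rewrite -subr_eq0 -tensor_actB; apply/eqP.
by apply/tensor_act_ideal/alg_piP; rewrite alg_pi_repr.
Qed.

Lemma env_act_linear q : linear (env_act q).
Proof. exact: tensor_act_linear. Qed.
HB.instance Definition _ q :=
  GRing.isLinear.Build K V V _ (env_act q) (env_act_linear q).

Lemma env_actB p q v : env_act (p - q) v = env_act p v - env_act q v.
Proof.
have -> : p - q = alg_pi (env_rel par br) (repr p - repr q).
  by apply: esym; apply: (etrans (raddfB _ _ _)); rewrite /= !alg_pi_repr.
exact: (etrans (env_act_pi _ v) (tensor_actB _ _ v)).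
Qed.

Lemma env_actM p q v : env_act (p * q) v = env_act p (env_act q v).
Proof.
have -> : p * q = alg_pi (env_rel par br) (repr p * repr q) by [].
exact: (etrans (env_act_pi _ v) (tensor_actM _ _ v)).
Qed.

Lemma env_act_gen x v : env_act (env_gen par br x) v = rho x v.
Proof. by rewrite env_act_pi tensor_act_gen. Qed.

Lemma env_act_scalar c v : env_act c%:A v = c *: v.
Proof.
have -> : c%:A = (alg_pi (env_rel par br) (c *: 1) : env par br).
  exact: (alg_pi_scale (env_rel par br) c 1).
by rewrite env_act_pi tensor_actZ tensor_act1.
Qed.

End EnvAction.

(** * Maps out of an induced module *)

Section InducedAction.
Variables (K : comNzRingType) (I : choiceType).
Variables (par : I -> bool) (br : I -> I -> {malg K[I]}).
Variables (V Q : lmodType K) (rho : I -> {linear V -> V}).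
Hypothesis rho_bracket : forall x y v,
  rho x (rho y v) - (-1) ^+ (par x && par y) *: rho y (rho x v)
  = lin_act rho (br x y) v.
Variables (h : pred I) (W : lmodType K) (act : I -> W -> W).
Variables (iota : {linear W -> V}) (p : {linear V -> Q}).
Hypothesis ker_stable : forall x v, p v = 0 -> p (rho x v) = 0.
Hypothesis iota_act : forall x w, h x -> p (rho x (iota w)) = p (iota (act x w)).

Local Notation U := (env par br).
Local Notation eact := (@env_act K I par br V rho).

(** Any element of the enveloping algebra acts by combinations of words in the
    generators, which preserve the kernel of [p] one letter at a time. *)
Lemma ker_stable_env (q : U) v : p v = 0 -> p (eact q v) = 0.
Proof.
move=> pv; rewrite /env_act /tensor_act /malg_sum linear_sum big1 // => m _ /=.
rewrite /scale_to linearZ /= (_ : p _ = 0) ?scaler0 // /word_act.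
by elim: (fmonom_val m) => //= x s; apply: ker_stable.
Qed.

Definition act_on (v : V) (q : U) : V := eact q v.
Lemma act_on_is_zmod_morphism v : zmod_morphism (act_on v).
Proof. by move=> a b; apply: env_actB. Qed.
HB.instance Definition _ v :=
  GRing.isZmodMorphism.Build _ _ (act_on v) (act_on_is_zmod_morphism v).

(** The map u (x) w |-> u . iota w on the free module whose quotient is the
    induced module.  The balancing relations need not go to zero, only into the
    kernel of [p]: the target is the quotient of V by that kernel, of which V
    provides representatives. *)
Definition free_map (z : {malg U[W]}) : V := malg_sum (fun w => act_on (iota w)) z.

Lemma free_mapB y z : free_map (y - z) = free_map y - free_map z.
Proof. exact: raddfB. Qed.

Lemma free_mapD y z : free_map (y + z) = free_map y + free_map z.
Proof. exact: raddfD. Qed.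

Lemma free_mapU u w : free_map << u *g w >> = eact u (iota w).
Proof. exact: malg_sumU. Qed.

Lemma free_mapZ a z : free_map (a *: z) = eact a (free_map z).
Proof.
rewrite /free_map (malg_sumEw _ (msuppZ_le _ _)) /malg_sum linear_sum.
apply: eq_bigr => w _; rewrite mcoeffZ.
exact: env_actM.
Qed.

Lemma free_map0 : free_map 0 = 0.
Proof. exact: raddf0. Qed.

Lemma env_act1 v : eact 1 v = v.
Proof. by rewrite -[in RHS](scale1r v) -(env_act_scalar rho_bracket) scale1r. Qed.

Lemma free_map_span z : submod_span (@ind_rel K I par br h W act) z ->
  p (free_map z) = 0.
Proof.
elim=> [|a x y rx _ ih]; first by rewrite free_map0 linear0.
rewrite free_mapD linearD /= ih addr0 free_mapZ.
apply: ker_stable_env; case: rx => [w w'|c w|x0 w hx0]; apply/eqP.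
- by rewrite !free_mapB !free_mapU !env_act1 (linearD iota) addrAC addrK subrr linear0.
- rewrite free_mapB !free_mapU env_act1 (env_act_scalar rho_bracket).
  by rewrite (linearZ_LR iota) subrr linear0.
- rewrite free_mapB !free_mapU env_act1 (env_act_gen rho_bracket).
  by rewrite linearB subr_eq0 iota_act.
Qed.

Local Notation M := (ind_mod par br h act).

(** The universal property of the induced module: [p \o ind_map] is well
    defined and equivariant, although [ind_map] itself depends on the chosen
    representatives. *)
Definition ind_map (m : M) : V := free_map (repr m).

Lemma ind_map_pi z : p (ind_map (lmod_pi _ z)) = p (free_map z).
Proof.
apply/eqP; rewrite -subr_eq0 -linearB -free_mapB.
by apply/eqP/free_map_span/lmod_piP; rewrite lmod_pi_repr.
Qed.

Lemma ind_mapD m m' : p (ind_map (m + m')) = p (ind_map m) + p (ind_map m').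
Proof.
have -> : m + m' = lmod_pi _ (repr m + repr m').
  by rewrite lmod_piD !lmod_pi_repr.
by rewrite ind_map_pi free_mapD linearD.
Qed.

Lemma ind_mapZ a (m : M) : p (ind_map (a *: m)) = p (eact a (ind_map m)).
Proof.
have -> : a *: m = lmod_pi _ (a *: repr m) by [].
by rewrite ind_map_pi free_mapZ.
Qed.

Lemma ind_map_gen x (m : M) :
  p (ind_map (env_gen par br x *: m)) = p (rho x (ind_map m)).
Proof. by rewrite ind_mapZ env_act_gen. Qed.

Lemma ind_map_scalar c (m : M) :
  p (ind_map ((c%:A : U) *: m)) = c *: p (ind_map m).
Proof. by rewrite ind_mapZ env_act_scalar // linearZ. Qed.

Lemma ind_map_tensor u w :
  p (ind_map (ind_tensor par br h act u w)) = p (eact u (iota w)).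
Proof. by rewrite ind_map_pi free_mapU. Qed.

End InducedAction.

(** * Generators of the enveloping algebra and of induced modules *)

Lemma scale_comm (R : pzRingType) (M : lmodType R) (a b : R) (m : M) :
  a * b = b * a -> a *: (b *: m) = b *: (a *: m).
Proof. by move=> ab; rewrite !scalerA ab. Qed.

Lemma scale_supercomm (R : pzRingType) (M : lmodType R) (a b s z : R) (m : M) :
  a * b = s * (b * a) + z -> a *: (b *: m) = s *: (b *: (a *: m)) + z *: m.
Proof. by move=> ab; rewrite scalerA ab scalerDl !scalerA mulrA. Qed.

Lemma sign_alg (K : pzRingType) (A : lalgType K) (b : bool) :
  ((-1) ^+ b)%:A = (-1) ^+ b :> A.
Proof. by case: b; rewrite ?scaleN1r ?scale1r. Qed.

Section EnvGenerators.
Variables (K : comNzRingType) (I : choiceType).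
Variables (par : I -> bool) (br : I -> I -> {malg K[I]}).
Local Notation U := (env par br).
Local Notation gen := (env_gen par br).
Local Notation pi := (alg_pi (env_rel par br)).

Lemma env_scalarE (c : K) : (c%:A : U) = pi (c *: 1).
Proof. exact: (alg_pi_scale (env_rel par br) c 1). Qed.

Lemma env_piM a b : (pi a : U) * pi b = pi (a * b).
Proof. exact: alg_piM. Qed.

Lemma malg_gen_scalar (T : monomType) (c : K) (m : T) :
  << m >> * (c *: 1) = (c *: 1) * << m >> :> {malg K[T]}.
Proof.
rewrite -mul_malgC mulr1 !malgM_def !fgmulUU.
by rewrite mulm1 mul1m mulrC.
Qed.

Lemma env_pi_monom_scalar (m : {fmonom I}) c :
  (pi << m >> : U) * c%:A = c%:A * (pi << m >> : U).
Proof.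
by rewrite env_scalarE (env_piM << m >>) (env_piM (c *: 1)) malg_gen_scalar.
Qed.

Lemma env_gen_scalar x c : gen x * c%:A = c%:A * gen x :> U.
Proof. exact: env_pi_monom_scalar. Qed.

Lemma env_pi_relation (a b c : {malg K[{fmonom I}]}) :
  env_rel par br (a - b - c) -> pi a = pi b + pi c :> U.
Proof.
move=> r; apply: etrans (alg_piD _ _ _); apply/alg_piP.
rewrite opprD addrA -[X in ideal_span _ X]addr0 -[X in X + _]mul1r.
rewrite -[X in X + _]mulr1; exact: ideal_spanP (ideal_span0 _).
Qed.

Lemma env_pi_sum (J : Type) (r : seq J) (c : J -> K) (F : J -> _) :
  (pi (\sum_(i <- r) c i *: F i) : U) = \sum_(i <- r) (c i)%:A * (pi (F i) : U).
Proof.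
elim: r => [|i r ih]; first by rewrite !big_nil; apply: alg_pi0.
rewrite !big_cons -ih env_scalarE (env_piM (c i *: 1)) -scalerAl mul1r.
exact: alg_piD.
Qed.

Lemma env_pi_sign (s : bool) a :
  pi ((-1) ^+ s * a) = (-1) ^+ s * (pi a : U) :> U.
Proof.
case: s; rewrite ?expr1 ?expr0.
  rewrite (mulN1r a) (mulN1r (pi a : U)).
  exact: raddfN.
by rewrite (mul1r a) (mul1r (pi a : U)).
Qed.

Definition scalar_gen (x : I) (c : K) : U := c%:A * gen x.
Lemma scalar_gen_is_zmod_morphism x : zmod_morphism (scalar_gen x).
Proof. by move=> a b; rewrite /scalar_gen scalerBl mulrBl. Qed.
HB.instance Definition _ x := GRing.isZmodMorphism.Build _ _ (scalar_gen x)
  (scalar_gen_is_zmod_morphism x).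

Definition env_lin (z : {malg K[I]}) : U := malg_sum scalar_gen z.

Lemma env_lin0 : env_lin 0 = 0.
Proof. exact: raddf0. Qed.

Lemma env_linU c x : env_lin << c *g x >> = c%:A * gen x.
Proof. exact: malg_sumU. Qed.

Lemma env_pi_supercomm a b (s : bool) z :
  env_rel par br (a * b - (-1) ^+ s * (b * a) - tlin z) ->
  (pi a : U) * pi b = (-1) ^+ s * ((pi b : U) * pi a)
    + env_lin z :> U.
Proof.
move=> /env_pi_relation; rewrite env_pi_sum (env_piM a b) => ->.
by rewrite (env_pi_sign s (b * a)) (env_piM b a).
Qed.

Lemma env_genM x y : gen x * gen y =
  (-1) ^+ (par x && par y) * (gen y * gen x)
  + env_lin (br x y) :> U.
Proof. exact: env_pi_supercomm (EnvRel par br x y). Qed.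

Lemma gen_scale_comm (M : lmodType U) x c (m : M) :
  gen x *: ((c%:A : U) *: m) = (c%:A : U) *: (gen x *: m).
Proof. exact/scale_comm/env_gen_scalar. Qed.

Lemma gen_gen_scale (M : lmodType U) x y (m : M) :
  gen x *: (gen y *: m) =
  (((-1) ^+ (par x && par y))%:A : U) *: (gen y *: (gen x *: m))
  + env_lin (br x y) *: m.
Proof. by apply: scale_supercomm; rewrite sign_alg; apply: env_genM. Qed.

Lemma gen_gen_scale0 (M : lmodType U) x y (m : M) : br x y = 0 ->
  gen x *: (gen y *: m) = (-1) ^+ (par x && par y) *: (gen y *: (gen x *: m)).
Proof. by move=> b0; rewrite gen_gen_scale b0 env_lin0 scale0r addr0 sign_alg. Qed.

Lemma gen_gen_scaleU (M : lmodType U) x y z c (m : M) : br x y = << c *g z >> ->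
  gen x *: (gen y *: m) =
  (-1) ^+ (par x && par y) *: (gen y *: (gen x *: m))
  + (c%:A : U) *: (gen z *: m).
Proof.
move=> bz; rewrite gen_gen_scale bz sign_alg env_linU; congr (_ + _).
exact: esym (scalerA _ _ _).
Qed.

Lemma env_pi_word (s : seq I) :
  pi << FMonom s >> = \prod_(x <- s) gen x :> U.
Proof.
elim: s => [|x s ih].
  by rewrite big_nil -[RHS]/(pi 1); congr (pi << _ >>); rewrite -fmoneE.
rewrite big_cons -ih (env_piM (tgen K x)) malgM_def fgmulUU mulr1.
by congr (pi << _ >>); rewrite [RHS]fmmulE fmuE.
Qed.

Section Span.
Variables (M : lmodType U) (P : M -> Prop).
Hypotheses (P0 : P 0) (PD : forall m m', P m -> P m' -> P (m + m')).
Hypothesis PZ : forall c m, P m -> P ((c%:A : U) *: m).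
Hypothesis Pgen : forall x m, P m -> P (gen x *: m).

Lemma env_stable (q : U) m : P m -> P (q *: m).
Proof.
move=> Pm; rewrite -[q]alg_pi_repr [repr q]monalgE.
have -> : pi (\sum_(k <- msupp (repr q)) << (repr q)@_k *g k >>) =
    \sum_(k <- msupp (repr q)) ((repr q)@_k)%:A * (pi << k >> : U) :> U.
  rewrite -env_pi_sum; congr pi; apply: eq_bigr => k _.
  by rewrite -mul_malgC malgM_def fgmulUU mul1m mulr1.
rewrite scaler_suml; elim/big_ind: _ => // -[s] _.
rewrite -scalerA; apply: PZ; rewrite env_pi_word.
elim: s => [|x s ih]; first by rewrite big_nil scale1r.
by rewrite big_cons -scalerA; apply: Pgen.
Qed.
End Span.

Lemma env_lin_scale (M : lmodType U) (P : M -> Prop) z m :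
  P 0 -> (forall m m', P m -> P m' -> P (m + m')) ->
  (forall c m, P m -> P ((c%:A : U) *: m)) ->
  (forall x, P (gen x *: m)) -> P (env_lin z *: m).
Proof.
move=> P0 PD PZ Pgen; rewrite /env_lin /malg_sum scaler_suml.
elim/big_ind: _ => // x _ /=.
by rewrite /scalar_gen -(scalerA (_%:A : U)); apply: PZ.
Qed.

Section InducedSpan.
Variables (h : pred I) (W : lmodType K) (act : I -> W -> W).
Local Notation M := (ind_mod par br h act).
Local Notation tens := (ind_tensor par br h act).

Lemma ind_tensorE q w : tens q w = q *: tens 1 w.
Proof.
rewrite -[RHS]/(lmod_quot_scale _ (lmod_pi _ _)) lmod_pi_scale.
congr lmod_pi; apply/malgP => k.
by rewrite [RHS]mcoeffZ !mcoeffU mulrnAr mulr1.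
Qed.

Lemma ind_tensor_rel q w w' : ind_rel h act (<< q *g w >> - << w' >>) ->
  q *: tens 1 w = tens 1 w'.
Proof.
move=> r; rewrite -ind_tensorE; apply/lmod_piP.
rewrite -[X in submod_span _ X]addr0 -[X in X + _]scale1r.
exact: submod_spanP (submod_span0 _).
Qed.

Lemma ind_tensorZ c w : (c%:A : U) *: tens 1 w = tens 1 (c *: w).
Proof. by apply: ind_tensor_rel; apply: IndScale. Qed.

Lemma ind_tensor_act x w : h x -> gen x *: tens 1 w = tens 1 (act x w).
Proof. by move=> hx; apply: ind_tensor_rel; apply: IndAct. Qed.

(** The induced module is generated by 1 (x) W, so a predicate closed under
    sums, scalars and generators holds everywhere once it holds there. *)
Lemma ind_mod_generated (P : M -> Prop) :
  P 0 -> (forall m m', P m -> P m' -> P (m + m')) ->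
  (forall c m, P m -> P ((c%:A : U) *: m)) ->
  (forall x m, P m -> P (gen x *: m)) ->
  (forall w, P (tens 1 w)) -> forall m, P m.
Proof.
move=> P0 PD PZ Pgen Pt m; rewrite -[m]lmod_pi_repr [repr m]monalgE.
elim: (finmap.enum_fset _) => [|w s ih].
  by rewrite big_nil (_ : lmod_pi _ 0 = 0) //; apply: raddf0.
rewrite big_cons lmod_piD; apply: (PD) => //.
rewrite -[lmod_pi _ << _ *g w >>]/(tens _ w) ind_tensorE.
exact: (env_stable P0 PD PZ Pgen).
Qed.
End InducedSpan.

End EnvGenerators.

(** * A representation of K(1,2)_+ on two-sided sequences *)

(** The components of the model: the polynomial multiples of v, of G^+ v and
    G^- v, and of (G^+ G^- - L) v, where all G and L are lowering operators.
    The last vector is used in place of G^+ G^- v because L_1 and J_1 send it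
    to Lambda v and 2 Delta v, and the exchange of + and - only changes its
    sign. *)
Variant fiber := One | Odd of bool | Top.

Definition fiber_code u : option (option bool) :=
  match u with One => None | Odd e => Some (Some e) | Top => Some None end.

Definition fiber_decode c : fiber :=
  match c with None => One | Some (Some e) => Odd e | Some None => Top end.

Lemma fiber_codeK : cancel fiber_code fiber_decode.
Proof. by case. Qed.

HB.instance Definition _ := Countable.copy fiber (can_type fiber_codeK).


Section Series.
Variables (K : numFieldType) (Delta Lambda : K).

Local Notation series := (fiber -> int -> K^o).
Implicit Types (F : series) (a k : int) (e : bool).

(** The eigenvalue of the adjoint action of J_0 on G^+ ([true]) and G^-. *)
Definition charge e : K := if e then 1 else -1.

(** Heuristically F u k is the coefficient of the divided power L^k / k! applied
    to the vector of component u; for [Top] it is that of L^(k-1) / (k-1)!.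
    Moving L_(a-1) through L^k produces the iterated commutators
    a (a - 1) ... (a - j + 1) L_(a-1-j), of which only L_(-1), L_0 and L_1 act
    nontrivially on the four vectors.  The offset for [Top] makes all the terms
    of a component involve F at the same position.  The argument a is the
    shifted index of [kbasis], extended to all integers; [actJ] and [actG] are
    obtained likewise. *)
Definition actL a F : series := fun u k =>
  match u with
  | One => (k%:~R + a%:~R * Delta) * F One (k + a - 1)
           + a%:~R * (a%:~R - 1) / 2 * Lambda * F Top (k + a - 1)
  | Odd e => (k%:~R + a%:~R * (Delta + 1 / 2)) * F (Odd e) (k + a - 1)
  | Top => (k%:~R - 1 + a%:~R * (Delta + 1)) * F Top (k + a - 1)
  end.

Definition actJ a F : series := fun u k =>
  match u with
  | One => Lambda * F One (k + a) + 2 * Delta * a%:~R * F Top (k + a)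
  | Odd e => (Lambda + charge e) * F (Odd e) (k + a)
  | Top => Lambda * F Top (k + a)
  end.

Definition actG e a F : series := fun u k =>
  let s := charge e in
  match u with
  | One => (k%:~R + a%:~R * (2 * Delta + s * Lambda)) * F (Odd (~~ e)) (k + a - 1)
  | Odd e' => if e' == e then
      F One (k + a)
      - s * (k%:~R + a%:~R * (2 * Delta + s * Lambda + 1)) * F Top (k + a)
      else 0
  | Top => s * F (Odd (~~ e)) (k + a - 1)
  end.

Definition series_act (x : kbasis) (F : series) : series :=
  match x with
  | kL a => actL a%:Z F
  | kJ a => actJ a%:Z F
  | kG e a => actG e a%:Z F
  end.

Lemma series_act_linear x : linear (series_act x).
Proof.
move=> c F F'; apply/funext => u; apply/funext => k.
have E u' k' : (c *: F + F') u' k' = c * F u' k' + F' u' k' by [].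
move: (c *: F + F') E => G E.
rewrite -[RHS]/(c * series_act x F u k + series_act x F' u k).
by case: x u => [a|a|e a] [|e'|] /=; rewrite /= ?E; try (case: eqP => _); ring.
Qed.
HB.instance Definition _ x :=
  GRing.isLinear.Build K series series _ (series_act x) (series_act_linear x).

(** Every identity to be checked involves F at a single position, written in
    several ways; this makes the occurrences syntactically equal. *)
Ltac same_index F :=
  match goal with |- context [F _ ?N] =>
    repeat match goal with |- context [F _ ?j] =>
      lazymatch j with N => fail | _ => replace j with N by ring end end
  end.

Ltac check_component F := rewrite /= ?eqxx /=; rewrite ?intrD ?intrB ?intrM;
  try same_index F; rewrite /charge /=; field; rewrite ?pnatr_eq0 //.

(** The coefficient at L^k of the component [Top] is stored one position
    further, see [actL]. *)
Definition position (u : fiber) (k : nat) : int := if u is Top then k.+1 else k.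

Definition restr F : fiber -> nat -> K^o := fun u (k : nat) => F u (position u k).

Lemma restr_linear : linear restr.
Proof. by []. Qed.
HB.instance Definition _ :=
  GRing.isLinear.Build K series (fiber -> nat -> K^o) _ restr restr_linear.

(** The coefficients of [actL], [actJ] and [actG] vanish whenever the shift would
    carry a value from outside the range of [position] into that range. *)
Lemma restr_act x F : restr F = 0 -> restr (series_act x F) = 0.
Proof.
move=> F0; have Z u (k : int) : position u 0%N <= k -> F u k = 0.
  move=> hk; pose n := absz (k - position u 0%N)%R.
  have -> : k = position u n by rewrite {}/n; case: u hk => [|e|] /=; lia.
  by rewrite -[LHS]/(restr F u n) F0.
apply/funext => u; apply/funext => k; rewrite /restr -[RHS]/(0 : K).
have no_contribution c u' (j : int) : c = 0 \/ position u' 0%N <= j -> c * F u' j = 0 :> K.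
  by case=> [->|/Z ->]; rewrite ?mul0r ?mulr0.
case: x u => [a|a|e a] [|e'|] /=; try (case: eqP => // _);
  case: a => [|[|a]]; case: k => [|k] /=;
  repeat match goal with |- context [?c * F ?u ?j] =>
    rewrite (no_contribution c u j);
      [| first [right; rewrite /=; lia | left; ring]] end;
  try (rewrite (Z One); [|rewrite /=; lia]); ring.
Qed.

Lemma ratr_kdeg x : ratr (kdeg x) =
  match x with
  | kL a => a%:R - 1 | kJ a => a%:R | kG _ a => a%:R - 1 / 2
  end :> K.
Proof.
case: x => [a|a|e a] /=; rewrite ?rmorphB /= ?fmorphV ?ratr_nat ?rmorph1 ?div1r //.
by rewrite rmorph_nat.
Qed.

(** The truncated predecessor in the brackets is harmless, because the
    coefficient vanishes when it truncates. *)
Lemma act_pred_mode (op : int -> series -> series) (c : K) (a b : nat) F u k :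
  ((a + b = 0)%N -> c = 0) ->
  c * op (a + b).-1%N F u k = c * op (Posz a + Posz b - 1) F u k.
Proof.
case: (posnP (a + b)) => [ab /(_ ab) ->|ab _]; first by rewrite !mul0r.
by congr (_ * op _ F u k); lia.
Qed.

(** All modes and positions are integers here, so that each component of each
    bracket is one polynomial identity in the modes, the position, Delta and
    Lambda. *)
Lemma series_bracket x y F :
  series_act x (series_act y F)
    - (-1) ^+ (kodd x && kodd y) *: series_act y (series_act x F)
  = lin_act series_act (kbr K x y) F.
Proof.
have eqf (f g : series) : (forall u k, f u k = g u k) -> f = g.
  by move=> fg; apply/funext => u; apply/funext => k.
have sgn (b : bool) (f g : series) u k :
    (f - (-1) ^+ b *: g) u k = f u k - (if b then - g u k else g u k).
  by case: b; rewrite ?scaleN1r ?scale1r.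
have z c (g : series) u k : (c *: g) u k = c * g u k by [].
have D (f g : series) u k : (f + g) u k = f u k + g u k by [].
have O u k : (0 : series) u k = 0 by [].
apply: eqf => u k; rewrite sgn.
case: x => [a|a|[] a]; case: y => [b|b|[] b];
  rewrite /kbr ?ratr_kdeg ?lin_actD ?lin_actU ?lin_act0 ?D ?z ?O /= ?z;
  repeat match goal with |- context [?op (Posz (?a + ?b).-1) F u k] =>
    rewrite (act_pred_mode op);
      [|case: a b => [|?] [|?] // _; field; rewrite ?pnatr_eq0 //] end;
  rewrite ?PoszD /=; case: u => [|[]|]; check_component F.
Qed.

End Series.

(** * Spanning set of the module M(Delta, Lambda) *)

Lemma double_eq0 (K : numFieldType) (A : lalgType K) (M : lmodType A) (m : M) :
  m + m = 0 -> m = 0.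
Proof.
move=> mm; rewrite -[m]scale1r -[X in X *: _](scale1r (1 : A)).
have -> : (1 : K) = 2^-1 + 2^-1 by field.
by rewrite !scalerDl -scalerDr mm scaler0.
Qed.

Lemma scale_algM (K : pzRingType) (A : lalgType K) (M : lmodType A) a b (m : M) :
  ((a * b)%:A : A) *: m = (a%:A : A) *: ((b%:A : A) *: m).
Proof. by rewrite scalerA -scalerAl mul1r scalerA. Qed.

Section Lowering.
Variables (K : comNzRingType) (A : lalgType K) (M : lmodType A).
Variables (L : A) (G : bool -> A) (v : M).
Implicit Types (m : M) (e : bool).
Hypothesis L_scalar : forall c m, L *: ((c%:A : A) *: m) = (c%:A : A) *: (L *: m).
Hypothesis G_scalar : forall e c m,
  G e *: ((c%:A : A) *: m) = (c%:A : A) *: (G e *: m).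
Hypothesis lower_LG : forall e m, L *: (G e *: m) = G e *: (L *: m).
Hypothesis lower_anticomm : forall m,
  G true *: (G false *: m) = - (G false *: (G true *: m)) + (2%:A : A) *: (L *: m).
Hypothesis lower_sq : forall e m, G e *: (G e *: m) = 0.

Definition pbw_base (u : fiber) : M :=
  match u with
  | One => v
  | Odd e => G e *: v
  | Top => G true *: (G false *: v) - L *: v
  end.

Definition pbw (t : (fiber * nat)%type) : M := iter t.2 ( *:%R L) (pbw_base t.1).

Definition scaled_pbw t (c : K) : M := (c%:A : A) *: pbw t.
Lemma scaled_pbw_is_zmod_morphism t : zmod_morphism (scaled_pbw t).
Proof. by move=> a b; rewrite /scaled_pbw !scalerBl. Qed.
HB.instance Definition _ t := GRing.isZmodMorphism.Build _ _ (scaled_pbw t)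
  (scaled_pbw_is_zmod_morphism t).

Definition pbw_comb (z : {malg K[(fiber * nat)%type]}) : M := malg_sum scaled_pbw z.

Lemma pbw_comb0 : pbw_comb 0 = 0. Proof. exact: raddf0. Qed.
Lemma pbw_combD y z : pbw_comb (y + z) = pbw_comb y + pbw_comb z. Proof. exact: raddfD. Qed.
Lemma pbw_combU c t : pbw_comb << c *g t >> = (c%:A : A) *: pbw t.
Proof. exact: malg_sumU. Qed.
Lemma pbw_combZ c z : pbw_comb (c *: z) = (c%:A : A) *: pbw_comb z.
Proof.
rewrite /pbw_comb (malg_sumEw _ (msuppZ_le _ _)) /malg_sum scaler_sumr.
apply: eq_bigr => t _; rewrite mcoeffZ /= /scaled_pbw.
exact: scale_algM.
Qed.

Definition in_span m := exists z, m = pbw_comb z.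

Lemma in_span0 : in_span 0. Proof. by exists 0; rewrite pbw_comb0. Qed.
Lemma in_spanD m m' : in_span m -> in_span m' -> in_span (m + m').
Proof. by move=> [z ->] [z' ->]; exists (z + z'); rewrite pbw_combD. Qed.
Lemma in_spanZ c m : in_span m -> in_span ((c%:A : A) *: m).
Proof. by move=> [z ->]; exists (c *: z); rewrite pbw_combZ. Qed.
Lemma in_spanN m : in_span m -> in_span (- m).
Proof. by move=> /(in_spanZ (-1)); rewrite !scaleN1r. Qed.
Lemma span_pbw u k : in_span (iter k ( *:%R L) (pbw_base u)).
Proof. by exists << (u, k) >>; rewrite pbw_combU !scale1r. Qed.

Lemma span_gen x m : (forall c m', x *: ((c%:A : A) *: m') = (c%:A : A) *: (x *: m')) ->
  (forall t, in_span (x *: pbw t)) ->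
  in_span m -> in_span (x *: m).
Proof.
move=> cx hx [z ->]; rewrite /pbw_comb /malg_sum scaler_sumr.
elim/big_ind: _ => [||t _]; [exact: in_span0 | exact: in_spanD |].
by rewrite /= /scaled_pbw cx; apply: in_spanZ.
Qed.

Lemma span_L m : in_span m -> in_span (L *: m).
Proof. by apply: (span_gen L_scalar) => -[u k]; apply: (span_pbw u k.+1). Qed.

(** As G e commutes with L, it is enough to apply it to the four vectors of
    [pbw_base]; the anticommutator then rewrites the result in terms of
    them. *)
Lemma span_G e m : in_span m -> in_span (G e *: m).
Proof.
apply: (span_gen (G_scalar e)) => -[u k]; rewrite /pbw /=.
have -> : G e *: iter k ( *:%R L) (pbw_base u) =
          iter k ( *:%R L) (G e *: pbw_base u).
  by elim: k => [//|k ih]; rewrite !iterS -lower_LG ih.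
suff: in_span (G e *: pbw_base u).
  by elim: k => [//|k ih] h; rewrite iterS; apply: span_L (ih h).
have Sv : in_span v := span_pbw One 0.
have So e' : in_span (G e' *: v) := span_pbw (Odd e') 0.
have St : in_span (G true *: (G false *: v)).
  rewrite -[X in in_span X](subrK (L *: v)).
  exact: in_spanD (span_pbw Top 0) (span_L Sv).
case: u => [|e'|]; [exact: So| |].
  rewrite /=; have [<-|ne] := eqVneq e e'.
    by rewrite lower_sq; apply: in_span0.
  case: e ne => ne.
    by move: ne; case: e' => // _; exact: St.
  have -> : e' = true by move: ne; case: e'.
  have := lower_anticomm v; move/(congr1 -%R); rewrite opprD opprK => /eqP.
  rewrite eq_sym subr_eq => /eqP ->.
  by apply: in_spanD (in_spanN St) _; apply/in_spanZ/span_L.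
rewrite /= scalerBr -lower_LG; apply: in_spanD; last by apply/in_spanN/span_L/So.
case: e; first by rewrite lower_sq; apply: in_span0.
have := lower_anticomm (G false *: v); rewrite lower_sq scaler0.
move/esym/eqP; rewrite addrC subr_eq0 => /eqP <-.
by apply/in_spanZ/span_L/So.
Qed.

End Lowering.

Section Verma.
Variables (K : numFieldType) (Delta Lambda : K).
Local Notation U := (UK12 K).
Local Notation M := (verma Delta Lambda).
Local Notation v := (verma_v Delta Lambda).
Local Notation gen := (kgen K).
Local Notation L := (gen (kL 0)).
Local Notation G := (fun e => gen (kG e 0)).
Implicit Types (m : M) (e : bool).

Lemma kL0E x :
  kL0 x = match x with kL 0 | kG _ 0 => false | _ => true end.
Proof.
rewrite /kL0; case: x => [[|a]|a|e [|a]] /=; apply/idP; lra || idtac.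
- by rewrite subr_ge0 ler1n.
- by rewrite ler0n.
- by rewrite subr_ge0; apply: (@le_trans _ _ 1); [lra|rewrite ler1n].
Qed.

Lemma gen_scalar x c (m : M) :
  gen x *: ((c%:A : U) *: m) = (c%:A : U) *: (gen x *: m).
Proof. exact: gen_scale_comm. Qed.

Lemma gen_gen x y (m : M) : gen x *: (gen y *: m) =
  (((-1) ^+ (kodd x && kodd y))%:A : U) *: (gen y *: (gen x *: m))
  + (env_lin kodd (kbr K) (kbr K x y) : U) *: m.
Proof. exact: gen_gen_scale. Qed.

Lemma gen_vacuum x : kL0 x -> gen x *: v = (kweight Delta Lambda x)%:A *: v.
Proof.
move=> hx; rewrite /verma_v [RHS]ind_tensorZ.
exact: (@ind_tensor_act K _ kodd (kbr K) kL0 _ (kact Delta Lambda) x 1 hx).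
Qed.

(** The submodule generated from v by the elements of negative degree alone. *)
Inductive lowered : M -> Prop :=
| Lowered0 : lowered 0
| LoweredV : lowered v
| LoweredD m m' : lowered m -> lowered m' -> lowered (m + m')
| LoweredZ c m : lowered m -> lowered ((c%:A : U) *: m)
| LoweredGen x m : ~~ kL0 x -> lowered m -> lowered (gen x *: m).

(** A generator is moved through a lowering operator at the cost of a bracket.
    As the induction hypothesis concerns all generators, it covers both the
    exchanged product and the bracket. *)
Lemma lowered_gen x m : lowered m -> lowered (gen x *: m).
Proof.
move=> lm; elim: lm x => {m} [x||m m' _ ih _ ih' x|c m _ ih x|y m hy lm ih x].
- by rewrite scaler0; apply: Lowered0.
- move=> x; case: (boolP (kL0 x)) => hx; last by apply: LoweredGen (LoweredV).
  by rewrite gen_vacuum //; apply: LoweredZ LoweredV.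
- by rewrite scalerDr; apply: LoweredD.
- by rewrite gen_scalar; apply: LoweredZ.
rewrite gen_gen; apply: LoweredD.
  by apply: LoweredZ; apply: LoweredGen => //; apply: ih.
apply: env_lin_scale (ih) => //.
- exact: Lowered0.
- exact: LoweredD.
- exact: LoweredZ.
Qed.

Lemma all_lowered m : lowered m.
Proof.
apply: (@ind_mod_generated K _ kodd (kbr K) kL0 _ (kact Delta Lambda) lowered) => //.
- exact: Lowered0.
- exact: LoweredD.
- exact: LoweredZ.
- exact: lowered_gen.
move=> c; have -> : ind_tensor kodd (kbr K) kL0 (kact Delta Lambda) 1 c
   = (c%:A : U) *: v by rewrite ind_tensorZ -[c in LHS]mulr1.
exact: LoweredZ LoweredV.
Qed.

Lemma lower_LG e m : L *: (gen (kG e 0) *: m) = gen (kG e 0) *: (L *: m).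
Proof.
rewrite -[RHS]scale1r; apply: (@gen_gen_scale0 K _ kodd (kbr K) M (kL 0) (kG e 0) m).
by rewrite /kbr !ratr_kdeg (_ : _ - _ = 0) ?monalgU0 //; field.
Qed.

Lemma lower_anticomm m :
  gen (kG true 0) *: (gen (kG false 0) *: m) =
  - (gen (kG false 0) *: (gen (kG true 0) *: m)) + (2%:A : U) *: (L *: m).
Proof.
rewrite -[X in X + _]scaleN1r.
apply: (@gen_gen_scaleU K _ kodd (kbr K) M (kG true 0) (kG false 0) (kL 0) 2 m).
by rewrite /kbr subrr monalgU0 addr0.
Qed.

Lemma lower_sq e m : gen (kG e 0) *: (gen (kG e 0) *: m) = 0.
Proof.
apply: (@double_eq0 K); apply/eqP; rewrite addr_eq0 -[X in _ == X]scaleN1r.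
apply/eqP; apply: (@gen_gen_scale0 K _ kodd (kbr K) M (kG e 0) (kG e 0) m).
by case: e.
Qed.


Lemma pbw_span m : in_span L G v m.
Proof.
elim: (all_lowered m) => {m} [||m m' _ + _|c m _|x m hx _].
- exact: in_span0.
- exact: (span_pbw L G v One 0).
- exact: in_spanD.
- exact: in_spanZ.
move: hx; rewrite kL0E; case: x => [[|a]|a|e [|a]] // _.
  apply: span_L => c m'; exact: gen_scalar.
exact: (span_G (fun c m' => gen_scalar (kL 0) c m')
  (fun e' c m' => gen_scalar (kG e' 0) c m') lower_LG lower_anticomm lower_sq).
Qed.
End Verma.

(** * Coordinates on M(Delta, Lambda) *)

Section Coordinates.
Variables (K : numFieldType) (Delta Lambda : K).
Local Notation U := (UK12 K).
Local Notation M := (verma Delta Lambda).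
Local Notation v := (verma_v Delta Lambda).
Local Notation gen := (kgen K).
Local Notation ch := (charge K).
Local Notation series := (fiber -> int -> K^o).
Local Notation L := (gen (kL 0)).
Local Notation G e := (gen (kG e 0)).
Implicit Types (m : M) (e : bool) (F : series).

Definition vac (c : K^o) : series := fun u k => if u is One then (k == 0)%:R * c else 0.

Lemma vac_linear : linear vac.
Proof.
move=> c a b; apply/funext => u; apply/funext => k.
rewrite -[RHS]/(c * vac a u k + vac b u k).
by case: u => [|e|] /=; rewrite ?mulr0 ?addr0 // mulrDr mulrCA.
Qed.
HB.instance Definition _ :=
  GRing.isLinear.Build K K^o series _ vac vac_linear.

(** The delta function at the origin satisfies the relations that define v only
    modulo the kernel of [restr]: for instance L_1 sends it to a function
    supported at position - 1. *)
Lemma vac_act x c : kL0 x ->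
  restr (series_act Delta Lambda x (vac c)) = restr (vac (kact Delta Lambda x c)).
Proof.
rewrite kL0E => hx; apply/funext => u; apply/funext => k; rewrite /restr /kact.
rewrite -[_ *: c]/(kweight Delta Lambda x * c).
have T (j : int) : j = 0 -> (j == 0) = true by move->.
have F (j : int) : j <> 0 -> (j == 0) = false by move/eqP/negPf.
case: x hx => [[|[|a]]|[|a]|e [|a]] // _; case: u => [|e'|] //=; case: k => [|k];
  repeat match goal with |- context [@eq_op _ ?j _] =>
    first [rewrite (T j); [|lia] | rewrite (F j); [|lia]] end;
  try (case: (e' == e)); rewrite ?mulr1n ?mulr0n; ring.
Qed.


Lemma vac_restr c u k : restr (vac c) u k = if u is One then (k == 0%N)%:R * c else 0.
Proof. by case: u. Qed.

Definition verma_lift m : series := ind_map (series_bracket Delta Lambda) vac m.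
Definition verma_coords m : fiber -> nat -> K^o := restr (verma_lift m).

Lemma verma_coordsD m m' : verma_coords (m + m') = verma_coords m + verma_coords m'.
Proof. exact: (ind_mapD _ (@restr_act _ Delta Lambda) vac_act). Qed.

Lemma verma_coords_scalar c m : verma_coords ((c%:A : U) *: m) = c *: verma_coords m.
Proof. exact: (ind_map_scalar _ (@restr_act _ Delta Lambda) vac_act). Qed.

Lemma verma_coords_gen x m :
  verma_coords (gen x *: m) = restr (series_act Delta Lambda x (verma_lift m)).
Proof. exact: (ind_map_gen _ (@restr_act _ Delta Lambda) vac_act). Qed.

Lemma verma_coords_v : verma_coords v = restr (vac 1).
Proof.
rewrite /verma_coords (ind_map_tensor _ (@restr_act _ Delta Lambda) vac_act).
by rewrite env_act1 //; apply: series_bracket.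
Qed.
End Coordinates.

(** * Singular vectors in coordinates *)

Section Classification.
Variables (K : numFieldType) (Delta Lambda : K).
Variables (A : lalgType K) (M : lmodType A) (gen : kbasis -> A) (v : M).
Local Notation ch := (charge K).
Local Notation series := (fiber -> int -> K^o).
Local Notation L := (gen (kL 0)).
Local Notation G e := (gen (kG e 0)).
Implicit Types (m : M) (e : bool) (F : series).

Variable lift : M -> series.
Let coords m : fiber -> nat -> K^o := restr (lift m).
Hypothesis coordsD : forall m m', coords (m + m') = coords m + coords m'.
Hypothesis coords_scalar : forall c m, coords ((c%:A : A) *: m) = c *: coords m.
Hypothesis coords_gen : forall x m,
  coords (gen x *: m) = restr (series_act Delta Lambda x (lift m)).
Hypothesis coords_v : forall u k, coords v u k = if u is One then (k == 0%N)%:R else 0.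
Hypothesis spanning : forall m, in_span L (fun e => G e) v m.

Lemma coordsDE m m' u k : coords (m + m') u k = coords m u k + coords m' u k.
Proof. by rewrite coordsD. Qed.

Lemma coordsZE c m u k : coords ((c%:A : A) *: m) u k = c * coords m u k.
Proof. by rewrite coords_scalar. Qed.

Lemma coordsNE m u k : coords (- m) u k = - coords m u k.
Proof.
by rewrite -scaleN1r -[X in X *: _](scaleN1r (1 : A)) coordsZE mulN1r.
Qed.

Lemma coords0E u k : coords 0 u k = 0.
Proof. by rewrite -(subrr v) coordsDE coordsNE subrr. Qed.

(** The truncated predecessors in [coordsL], [coordsJ] and [coordsG] only
    truncate where their coefficient vanishes, as in [restr_act]. *)
Lemma lift_term m (c : K) u (j : int) k :
  c = 0 \/ j = position u k -> c * lift m u j = c * coords m u k.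
Proof. by case=> ->; rewrite ?mul0r. Qed.

Lemma coordsL n m u k : coords (gen (kL n) *: m) u k =
  match u with
  | One => (k%:R + n%:R * Delta) * coords m One (k + n).-1
           + n%:R * (n%:R - 1) / 2 * Lambda * coords m Top (k + n).-2
  | Odd e => (k%:R + n%:R * (Delta + 1 / 2)) * coords m (Odd e) (k + n).-1
  | Top => (k%:R + n%:R * (Delta + 1)) * coords m Top (k + n).-1
  end.
Proof.
rewrite coords_gen /restr; case: u => [|e|] /=; rewrite -?pmulrn.
- rewrite (@lift_term m _ One _ (k + n).-1); last first.
    by case: k n => [|k] [|n]; first [right => /=; lia | left; ring].
  rewrite (@lift_term m _ Top _ (k + n).-2) //.
  by case: k n => [|k] [|[|n]]; first [right => /=; lia | left; ring].
- apply: lift_term.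
  by case: k n => [|k] [|n]; first [right => /=; lia | left; ring].
- rewrite -natr1 addrK; apply: lift_term.
  by case: k n => [|k] [|n]; first [right => /=; lia | left; ring].
Qed.

Lemma coordsJ n m u k : coords (gen (kJ n) *: m) u k =
  match u with
  | One => Lambda * coords m One (k + n)
           + 2 * Delta * n%:R * coords m Top (k + n).-1
  | Odd e => (Lambda + ch e) * coords m (Odd e) (k + n)
  | Top => Lambda * coords m Top (k + n)
  end.
Proof.
rewrite coords_gen /restr; case: u => [|e|] /=; rewrite -?pmulrn.
- congr (_ + _); apply: lift_term.
  by case: k n => [|k] [|n]; first [right => /=; lia | left; ring].
- by [].
- by congr (_ * _).
Qed.

Lemma coordsG e n m u k : coords (gen (kG e n) *: m) u k =
  match u with
  | One => (k%:R + n%:R * (2 * Delta + ch e * Lambda))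
           * coords m (Odd (~~ e)) (k + n).-1
  | Odd e' => if e' == e then
      coords m One (k + n)
      - ch e * (k%:R + n%:R * (2 * Delta + ch e * Lambda + 1))
        * coords m Top (k + n).-1
      else 0
  | Top => ch e * coords m (Odd (~~ e)) (k + n)
  end.
Proof.
rewrite coords_gen /restr; case: u => [|e'|] /=; rewrite -?pmulrn.
- apply: lift_term.
  by case: k n => [|k] [|n]; first [right => /=; lia | left; ring].
- case: eqP => // _; congr (_ - _); apply: lift_term.
  by case: k n => [|k] [|n]; first [right => /=; lia | left; ring].
- by apply: lift_term; right => /=; lia.
Qed.

Lemma coords_lower m u k : coords (L *: m) u k = k%:R * coords m u k.-1.
Proof. by rewrite coordsL addn0; case: u => *; ring. Qed.

Lemma coords_pbw_base u0 u k :
  coords (pbw_base L (fun e => G e) v u0) u k = if (u, k) == (u0, 0%N) then 1 else 0.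
Proof.
have Odd_eq e e' : (Odd e' == Odd e) = (e' == e) by [].
case: u0 => [|e|] /=; rewrite xpair_eqE.
- rewrite coords_v; case: u => [|e|] //=; by case: (k == 0%N).
- rewrite coordsG !coords_v !addn0; case: u => [|e'|] //=; rewrite ?mulr0 //.
  by rewrite subr0 Odd_eq; case: (e' == e) => //=; case: (k == 0%N).
- rewrite coordsDE coordsNE coords_lower !coordsG !coords_v !addn0.
  by case: u => [|[]|] //=; case: k => [|[|k]] //=; ring.
Qed.

(** L acts on coordinates by the shift with weight k, so L^k produces k!. *)
Lemma coords_pbw t u k :
  coords (pbw L (fun e => G e) v t) u k = if (u, k) == t then t.2`!%:R else 0.
Proof.
case: t => u0 n; rewrite /pbw /=; elim: n u k => [|n ih] u k /=.
  by rewrite coords_pbw_base fact0.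
rewrite coords_lower ih !xpair_eqE; case: k => [|k]; first by rewrite mul0r andbF.
rewrite /= eqSS; case: (u == u0) => /=; last by rewrite mulr0.
by case: eqP => [->|_]; rewrite ?mulr0 // factS natrM.
Qed.

Lemma coords_pbw_comb z t : coords (pbw_comb L (fun e => G e) v z) t.1 t.2 = t.2`!%:R * z@_t.
Proof.
rewrite /pbw_comb /malg_sum.
have -> : coords (\sum_(k <- msupp z) scaled_pbw L (fun e => G e) v k z@_k) t.1 t.2
  = \sum_(k <- msupp z) z@_k * (if t == k then k.2`!%:R else 0).
  elim: (finmap.enum_fset _) => [|k r ih]; first by rewrite !big_nil coords0E.
  by rewrite !big_cons coordsDE ih coordsZE coords_pbw -surjective_pairing.
rewrite [z in RHS]monalgE raddf_sum /= mulr_sumr; apply: eq_bigr => k _.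
rewrite mcoeffU eq_sym; case: eqP => [->|_]; last by rewrite !mulr0.
by rewrite mulr1n mulrC.
Qed.

(** Here characteristic zero enters: the spanning vectors have coordinates
    supported at distinct points, with value k! there. *)
Lemma coords_inj m m' : (forall u k, coords m u k = coords m' u k) -> m = m'.
Proof.
move=> mm; apply/eqP; rewrite -subr_eq0; apply/eqP.
have : forall u k, coords (m - m') u k = 0.
  by move=> u k; rewrite coordsDE coordsNE mm subrr.
have [z ->] := spanning (m - m') => z0.
suff -> : z = 0 by rewrite pbw_comb0.
apply/malgP => t; rewrite mcoeff0; apply/eqP.
have := z0 t.1 t.2; rewrite coords_pbw_comb => /eqP.
by rewrite mulf_eq0 pnatr_eq0 eqn0Ngt fact_gt0.
Qed.

(** [singular] for an arbitrary module; for [verma] the two are convertible. *)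
Definition is_singular m :=
  [/\ m != 0, (exists a : K, gen (kL 1) *: m = (a%:A : A) *: m),
      (exists b : K, gen (kJ 0) *: m = (b%:A : A) *: m) &
      forall x, 0 < kdeg x -> gen x *: m = 0].

Definition is_proper m := is_singular m /\ ~ (exists c : K, m = (c%:A : A) *: v).

Ltac fld := by field; rewrite ?pnatr_eq0.

Lemma kdeg_gt0 x : 0 < kdeg x ->
  match x with kL n => (1 < n)%N | kJ n | kG _ n => (0 < n)%N end.
Proof.
case: x => [n|n|e n] /=; first by rewrite subr_gt0 ltr1n.
  by rewrite ltr0n.
by case: n => //; lra.
Qed.

Lemma coords_neq0 m u k : coords m u k != 0 -> m != 0.
Proof. by apply: contraNneq => ->; rewrite coords0E. Qed.

Lemma not_vacuum m u k : u != One -> coords m u k != 0 ->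
  ~ (exists c : K, m = (c%:A : A) *: v).
Proof.
move=> u1 /eqP mu [c mc]; apply: mu; rewrite mc coordsZE coords_v.
by case: u u1 => // *; rewrite mulr0.
Qed.

Lemma coords_Gv e u k : coords (G e *: v) u k =
  if u is Odd e' then (if (e' == e) && (k == 0%N) then 1 else 0) else 0.
Proof.
by rewrite (coords_pbw_base (Odd e)) xpair_eqE; case: u.
Qed.

Lemma coords_GGv e u k : coords (G (~~ e) *: (G e *: v)) u k =
  match u with
  | One => if k == 1%N then 1 else 0
  | Odd _ => 0
  | Top => if k == 0%N then - ch e else 0
  end.
Proof.
rewrite coordsG !coords_Gv negbK addn0 eqxx /=.
case: u => [|e'|]; first by case: k => [|[|k]] /=; ring.
  by rewrite mulr0 subr0 if_same.
case: (k == 0%N); case: e; rewrite /charge /=; ring.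
Qed.

Lemma Gv_proper e : 2 * Delta - ch e * Lambda = 0 -> is_proper (G e *: v).
Proof.
move=> h; have nz : coords (G e *: v) (Odd e) 0 != 0.
  by rewrite coords_Gv !eqxx oner_eq0.
split; last exact: not_vacuum nz.
split; first exact: coords_neq0 nz.
- exists (Delta + 1 / 2); apply: coords_inj => u k.
  rewrite coordsL coordsZE addn1.
  case: u => [|e'|]; rewrite !coords_Gv /=; try fld.
  by case: (e' == e); case: k => [|k] /=; fld.
- exists (Lambda + ch e); apply: coords_inj => u k.
  rewrite coordsJ coordsZE addn0.
  case: u => [|e'|]; rewrite !coords_Gv /=; try ring.
  by case: eqP => [->|_]; case: k => [|k] /=; ring.
move=> x /kdeg_gt0; case: x => [[|[|n]]|[|n]|e' [|n]] // _;
  apply: coords_inj => u k; rewrite coords0E.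
- rewrite coordsL !addnS /=.
  by case: u => [|e''|]; rewrite !coords_Gv /= ?andbF; ring.
- rewrite coordsJ !addnS /=.
  by case: u => [|e''|]; rewrite !coords_Gv /= ?andbF; ring.
rewrite coordsG !addnS /= !coords_Gv /= !andbF.
case: u => [|e''|]; [|by case: eqP => // _; ring|ring].
case: eqP => [ee|_] /=; last by ring.
case: k => [|k] /=; last by ring.
case: n => [|n] /=; last by ring.
rewrite -ee in h; have hs : 2 * Delta + ch e' * Lambda = 0.
  by rewrite -h; case: (e') => /=; rewrite /charge /=; ring.
by rewrite mul1r hs; ring.
Qed.

Lemma GGv_proper e : Delta = - (1 / 2) -> Lambda = - ch e ->
  is_proper (G (~~ e) *: (G e *: v)).
Proof.
move=> hD hL; have nz : coords (G (~~ e) *: (G e *: v)) Top 0 != 0.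
  by rewrite coords_GGv oppr_eq0; case: e {hL}; rewrite ?oppr_eq0 oner_eq0.
split; last exact: not_vacuum nz.
have cc : ch e * ch e = 1 by case: e {hL nz}; rewrite /charge; ring.
split; first exact: coords_neq0 nz.
- exists (Delta + 1); apply: coords_inj => u k.
  rewrite coordsL coordsZE addn1.
  by case: u => [|e'|]; rewrite !coords_GGv /=; case: k => [|[|k]] /=; fld.
- exists Lambda; apply: coords_inj => u k.
  rewrite coordsJ coordsZE addn0.
  by case: u => [|e'|]; rewrite !coords_GGv /=; case: k => [|[|k]] /=; ring.
have hD2 : 2 * Delta = -1 by rewrite hD; fld.
move=> x /kdeg_gt0; case: x => [[|[|n]]|[|n]|e' [|n]] // _;
  apply: coords_inj => u k; rewrite coords0E.
- rewrite coordsL !addnS /=; case: u => [|e''|]; rewrite !coords_GGv /=; try ring.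
  case: k => [|k]; last by rewrite !addSn /=; ring.
  rewrite !add0n.
  case: n => [|n] /=; last by ring.
  (* L_1 sends the vector to (2 Delta - ch e * Lambda) v. *)
  rewrite hL hD; transitivity ((- 1 + ch e * ch e) : K); first by fld.
  by rewrite cc; ring.
- rewrite coordsJ !addnS /=; case: u => [|e''|]; rewrite !coords_GGv /=; try ring.
  rewrite hD2 hL; case: k => [|k] /=; last by ring.
  by case: n => [|n] /=; ring.
rewrite coordsG !addnS /= !coords_GGv /=; case: u => [|e''|]; try ring.
case: (e'' == e') => //; rewrite hD2 hL.
case: k => [|k] /=; last by ring.
case: n => [|n] /=; last by ring.
(* At this position the sum is 1 + ch e * Lambda, up to squares of charges. *)
have cc' : ch e' * ch e' = 1 by case: (e'); rewrite /charge; ring.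
transitivity (1 - (ch e' * ch e') * (ch e * ch e)); first by ring.
by rewrite cc cc'; ring.
Qed.

Lemma one_neq_opp1 : (1 : K) <> -1.
Proof. by move/eqP; rewrite -subr_eq0 opprK -(natrD _ 1 1) pnatr_eq0. Qed.

Lemma charge_neq0 e : ch e <> 0.
Proof. by move/eqP; case: e; rewrite /charge ?oppr_eq0 oner_eq0. Qed.

Lemma charge_inj e e' : ch e = ch e' -> e = e'.
Proof.
by case: e e' => [] []; rewrite /charge // => h; case: one_neq_opp1.
Qed.

Lemma scale_cancel (c d x : K) : c * x = d * x -> x <> 0 -> d = c.
Proof.
move/eqP; rewrite -subr_eq0 -mulrBl mulf_eq0 subr_eq0.
by case/orP => /eqP.
Qed.

Lemma weight_L0 a m u k : gen (kL 1) *: m = (a%:A : A) *: m ->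
  coords m u k <> 0 ->
  a = match u with One => k%:R + Delta | Odd _ => k%:R + (Delta + 1 / 2)
              | Top => k%:R + (Delta + 1) end.
Proof.
move=> La; apply: scale_cancel; rewrite -(coordsZE a) -La coordsL addn1.
by case: u => [|e|] /=; fld.
Qed.

Lemma weight_J0 b m u k : gen (kJ 0) *: m = (b%:A : A) *: m ->
  coords m u k <> 0 -> b = if u is Odd e then Lambda + ch e else Lambda.
Proof.
move=> Jb; apply: scale_cancel; rewrite -(coordsZE b) -Jb coordsJ addn0.
by case: u => [|e|] /=; ring.
Qed.

Lemma natr_addI (x : K) (k n : nat) : k%:R + x = n%:R + x -> k = n.
Proof. by move/addIr/eqP; rewrite eqr_nat => /eqP. Qed.

(** The eigenvalue of J_0 separates charges 1, - 1 and 0, and that of L_0 then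
    fixes the degree, in which charge 0 leaves at most one coordinate in each
    of the components [One] and [Top]. *)
Lemma weight_support m : is_singular m ->
  (exists e n, coords m (Odd e) n <> 0 /\
     forall u k, coords m u k <> 0 -> u = Odd e /\ k = n) \/
  (exists n, forall u k, coords m u k <> 0 ->
     match u with One => k = n | Odd _ => False | Top => k.+1 = n end).
Proof.
move=> [m0 [a La] [b Jb] _].
have [[u0 n] /= nz] : exists t, coords m t.1 t.2 <> 0.
  apply: contrapT => H; move/eqP: m0; apply; apply: coords_inj => u k.
  by rewrite coords0E; apply: contrapT => H'; apply: H; exists (u, k).
have aE := weight_L0 La nz; have bE := weight_J0 Jb nz.
have ch0 e : Lambda = Lambda + ch e -> False.
  by move/eqP; rewrite -[X in X == _]addr0 (inj_eq (addrI _)) eq_sym => /eqP /charge_neq0.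
case: u0 nz aE bE => [|e|] nz aE bE; [right|left|right].
- exists n => u k mu; have := weight_L0 La mu; have := weight_J0 Jb mu.
  rewrite {}aE {}bE; case: u {mu} => [_|e /ch0 //|_]; first by move/natr_addI.
  by rewrite (addrC Delta) addrA natr1 => /natr_addI.
- exists e, n; split=> // u k mu.
  have := weight_L0 La mu; have := weight_J0 Jb mu.
  rewrite {}aE {}bE; case: u {mu} => [/esym /ch0 //|e'|/esym /ch0 //].
  by move=> /addrI /charge_inj -> /natr_addI ->.
- exists n.+1 => u k mu; have := weight_L0 La mu; have := weight_J0 Jb mu.
  rewrite {}aE {}bE; case: u {mu} => [_|e /ch0 //|_].
    by rewrite (addrC Delta) addrA natr1 => /natr_addI.
  by move/natr_addI ->.
Qed.

Lemma singular_G e m u k : is_singular m -> coords (gen (kG e 1) *: m) u k = 0.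
Proof.
move=> [_ _ _ pos]; have p : 0 < kdeg (kG e 1) by rewrite /=; lra.
by rewrite (pos _ p) coords0E.
Qed.

Lemma singular_J m u k : is_singular m -> coords (gen (kJ 1) *: m) u k = 0.
Proof.
move=> [_ _ _ pos]; have p : 0 < kdeg (kJ 1) by rewrite /=; lra.
by rewrite (pos _ p) coords0E.
Qed.

(** The condition from G^(-e)_(1/2) has two components: the [Top] one excludes
    n > 0, the [One] one is the equation on Delta and Lambda. *)
Lemma odd_singular m e n : is_singular m -> coords m (Odd e) n <> 0 ->
  (forall u k, coords m u k <> 0 -> u = Odd e /\ k = n) ->
  (exists c : K, m = (c%:A : A) *: (G e *: v)) /\ 2 * Delta - ch e * Lambda = 0.
Proof.
move=> sm nz supp.
have n0 : n = 0%N.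
  case: n nz {supp} => // n nz; have := singular_G (~~ e) Top n sm.
  rewrite coordsG negbK addn1 => /eqP; rewrite mulf_eq0 => /orP[] /eqP //.
  by move/charge_neq0.
rewrite {}n0 in nz supp; split.
  exists (coords m (Odd e) 0); apply: coords_inj => u k.
  rewrite coordsZE coords_Gv.
  have [uk|uk] := pselect (u = Odd e /\ k = 0%N).
    by case: uk => -> ->; rewrite !eqxx mulr1.
  have -> : coords m u k = 0 by apply: contrapT => /supp.
  case: u uk => [|e'|] uk; rewrite ?mulr0 //.
  case: ifP => [/andP[/eqP ee /eqP k0]|_]; last by rewrite mulr0.
  by case: uk; rewrite ee k0.
have := singular_G (~~ e) One 0 sm; rewrite coordsG negbK add0n /=.
move/eqP; rewrite mulf_eq0 => /orP[] /eqP // <-.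
by case: (e); rewrite /charge /=; ring.
Qed.

(** With x and y the two coordinates, G^+_(1/2) and G^-_(1/2) give two equations
    whose half sum and half difference are x = Lambda y and
    (n + 2 Delta) y = 0.  The [One] component of J_1 gives
    Lambda^2 + 2 Delta = 0, and its [Top] component excludes n > 1. *)
Lemma even_singular m n : is_proper m ->
  (forall u k, coords m u k <> 0 ->
     match u with One => k = n | Odd _ => False | Top => k.+1 = n end) ->
  exists e, (exists c : K, m = (c%:A : A) *: (G (~~ e) *: (G e *: v))) /\
    Delta = - (1 / 2) /\ Lambda = - ch e.
Proof.
move=> [sm nv] supp.
have Odd0 e k : coords m (Odd e) k = 0 by apply: contrapT => /supp.
have One0 k : k <> n -> coords m One k = 0.
  by move=> kn; apply: contrapT => /supp.
have Top0 k : k.+1 <> n -> coords m Top k = 0.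
  by move=> kn; apply: contrapT => /supp.
case: n {supp} One0 Top0 => [|p] One0 Top0.
  case: nv; exists (coords m One 0); apply: coords_inj => u k.
  rewrite coordsZE coords_v; case: u => [|e|]; rewrite ?Odd0 ?Top0 ?mulr0 //.
  by case: k => [|k]; rewrite ?mulr1 // One0 ?mulr0.
set x := coords m One p.+1; set y := coords m Top p.
have E e : x = ch e * (p%:R + (2 * Delta + ch e * Lambda + 1)) * y.
  have := singular_G e (Odd e) p sm; rewrite coordsG eqxx addn1 mul1r /=.
  by move/eqP; rewrite subr_eq0 => /eqP.
have xE : x = Lambda * y.
  have -> : x = (x + x) / 2 by fld.
  by rewrite {1}(E true) (E false) /charge; fld.
have yE : (p.+1%:R + 2 * Delta) * y = 0.
  transitivity (x - Lambda * y); last by rewrite xE subrr.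
  by rewrite (E true) /charge -natr1; ring.
have y0 : y <> 0.
  move=> y0; move: sm => [/eqP + _ _ _]; apply; apply: coords_inj => u k.
  rewrite coords0E; case: u => [|e|]; rewrite ?Odd0 //.
    have [->|/One0 //] := pselect (k = p.+1).
    by rewrite -[LHS]/x xE y0 mulr0.
  by have [->|kp] := pselect (k = p); [|rewrite Top0 // => -[]].
have DE : p.+1%:R + 2 * Delta = 0.
  by move/eqP: yE; rewrite mulf_eq0 => /orP[] /eqP.
have LE : Lambda * Lambda + 2 * Delta = 0.
  have := singular_J One p sm; rewrite coordsJ addn1 /= -/x -/y xE => h.
  have /eqP : (Lambda * Lambda + 2 * Delta) * y = 0 by rewrite -[RHS]h; ring.
  by rewrite mulf_eq0 => /orP[] /eqP.
have p0 : p = 0%N.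
  case: p @x @y E xE yE y0 DE One0 Top0 => // p x y _ _ _ y0 DE _ _.
  have := singular_J Top p sm; rewrite coordsJ addn1 -/y => /eqP.
  rewrite mulf_eq0 => /orP[] /eqP // L0; exfalso.
  have D0 : 2 * Delta = 0 by rewrite -[RHS]LE L0; ring.
  by move/eqP: DE; rewrite D0 addr0 pnatr_eq0.
subst p.
have hD : Delta = - (1 / 2).
  have -> : Delta = ((1 + 2 * Delta) - 1) / 2 by fld.
  by rewrite DE; fld.
have [e eL] : exists e, Lambda = - ch e.
  have /eqP : (Lambda - 1) * (Lambda + 1) = 0.
    transitivity (Lambda * Lambda + 2 * Delta); last exact: LE.
    by rewrite hD; fld.
  rewrite mulf_eq0 subr_eq0 addr_eq0 => /orP[] /eqP ->.
    by exists false; rewrite /charge opprK.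
  by exists true.
exists e; split=> //; exists x; apply: coords_inj => u k.
rewrite coordsZE coords_GGv; case: u => [|e'|]; rewrite ?Odd0 ?mulr0 //.
  by case: eqP => [->|/One0 ->]; rewrite ?mulr1 ?mulr0.
case: k => [|k] /=; last by rewrite Top0 ?mulr0.
rewrite -/y xE eL; transitivity ((ch e * ch e) * y); last by ring.
by case: (e); rewrite /charge; ring.
Qed.

Lemma proper_classification m : is_proper m ->
  exists e, ((exists c : K, m = (c%:A : A) *: (G e *: v)) /\ 2 * Delta - ch e * Lambda = 0)
  \/ ((exists c : K, m = (c%:A : A) *: (G (~~ e) *: (G e *: v))) /\
      Delta = - (1 / 2) /\ Lambda = - ch e).
Proof.
move=> pm; have [sm _] := pm; case: (weight_support sm).
  by move=> [e [n [nz supp]]]; exists e; left; apply: odd_singular nz supp.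
by move=> [n /(even_singular pm) [e he]]; exists e; right.
Qed.

End Classification.

(** * Singular vectors of M(Delta, Lambda) *)

Section VermaSingular.
Variables (K : numFieldType) (Delta Lambda : K).
Local Notation U := (UK12 K).
Local Notation M := (verma Delta Lambda).
Local Notation v := (verma_v Delta Lambda).
Local Notation G e := (kgen K (kG e 0)).
Implicit Types (m : M) (e : bool).

Lemma verma_coords_vE u k :
  verma_coords v u k = if u is One then (k == 0%N)%:R else 0.
Proof. by rewrite verma_coords_v vac_restr; case: u => // *; rewrite mulr1. Qed.

Lemma verma_Gv e : 2 * Delta - charge K e * Lambda = 0 ->
  proper_singular (G e *: v).
Proof.
exact: (Gv_proper (@verma_coordsD K Delta Lambda) (@verma_coords_scalar K Delta Lambda)
  (@verma_coords_gen K Delta Lambda) verma_coords_vE (@pbw_span K Delta Lambda)).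
Qed.

Lemma verma_GGv e : Delta = - (1 / 2) -> Lambda = - charge K e ->
  proper_singular (G (~~ e) *: (G e *: v)).
Proof.
exact: (GGv_proper (@verma_coordsD K Delta Lambda) (@verma_coords_scalar K Delta Lambda)
  (@verma_coords_gen K Delta Lambda) verma_coords_vE (@pbw_span K Delta Lambda)).
Qed.

Lemma verma_classification m : proper_singular m ->
  exists e, ((exists c : K, m = (c%:A : U) *: (G e *: v)) /\
      2 * Delta - charge K e * Lambda = 0)
  \/ ((exists c : K, m = (c%:A : U) *: (G (~~ e) *: (G e *: v))) /\
      Delta = - (1 / 2) /\ Lambda = - charge K e).
Proof.
exact: (proper_classification (@verma_coordsD K Delta Lambda)
  (@verma_coords_scalar K Delta Lambda) (@verma_coords_gen K Delta Lambda) verma_coords_vE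
  (@pbw_span K Delta Lambda)).
Qed.

Lemma verma_singular_vectors :
  let Gp : U := kgen K (kG true 0) in
  let Gm : U := kgen K (kG false 0) in
  (forall w : M, proper_singular w ->
     [\/ (exists c : K, w = (c%:A : U) *: (Gp *: v)) /\ 2 * Delta - Lambda = 0,
         (exists c : K, w = (c%:A : U) *: (Gm *: (Gp *: v)))
           /\ Delta = - (1 / 2) /\ Lambda = - 1,
         (exists c : K, w = (c%:A : U) *: (Gm *: v)) /\ 2 * Delta + Lambda = 0 |
         (exists c : K, w = (c%:A : U) *: (Gp *: (Gm *: v)))
           /\ Delta = - (1 / 2) /\ Lambda = 1])
  /\ (2 * Delta - Lambda = 0 -> proper_singular (Gp *: v))
  /\ (Delta = - (1 / 2) -> Lambda = - 1 -> proper_singular (Gm *: (Gp *: v)))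
  /\ (2 * Delta + Lambda = 0 -> proper_singular (Gm *: v))
  /\ (Delta = - (1 / 2) -> Lambda = 1 -> proper_singular (Gp *: (Gm *: v))).
Proof.
move=> Gp Gm.
have ep : 2 * Delta - charge K true * Lambda = 2 * Delta - Lambda.
  by rewrite /charge mul1r.
have em : 2 * Delta - charge K false * Lambda = 2 * Delta + Lambda.
  by rewrite /charge mulN1r opprK.
split; last split; last split; last split.
- move=> w /verma_classification [[] [[cw h]|[cw [hD hL]]]].
  + by rewrite ep in h; apply: Or41.
  + exact: Or42.
  + by rewrite em in h; apply: Or43.
  + by rewrite /charge opprK in hL; apply: Or44.
- by move=> h; apply: (@verma_Gv true); rewrite ep.
- exact: (@verma_GGv true).
- by move=> h; apply: (@verma_Gv false); rewrite em.
- by move=> hD hL; apply: (@verma_GGv false) => //; rewrite hL /charge opprK.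
Qed.
End VermaSingular.

Local Open Scope complex_scope.

Theorem proposition4p1 (R : realType) (Delta Lambda : R[i]) :
  let v : verma Delta Lambda := verma_v Delta Lambda in
  let Gp : UK12 R[i] := kgen R[i] (kG true 0) in
  let Gm : UK12 R[i] := kgen R[i] (kG false 0) in
  (forall w : verma Delta Lambda, proper_singular w ->
     [\/ (exists c : R[i], w = c%:A *: (Gp *: v)) /\ 2 * Delta - Lambda = 0,
         (exists c : R[i], w = c%:A *: (Gm *: (Gp *: v)))
           /\ Delta = - (1 / 2) /\ Lambda = - 1,
         (exists c : R[i], w = c%:A *: (Gm *: v)) /\ 2 * Delta + Lambda = 0 |
         (exists c : R[i], w = c%:A *: (Gp *: (Gm *: v)))
           /\ Delta = - (1 / 2) /\ Lambda = 1])
  /\ (2 * Delta - Lambda = 0 -> proper_singular (Gp *: v))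
  /\ (Delta = - (1 / 2) -> Lambda = - 1 -> proper_singular (Gm *: (Gp *: v)))
  /\ (2 * Delta + Lambda = 0 -> proper_singular (Gm *: v))
  /\ (Delta = - (1 / 2) -> Lambda = 1 -> proper_singular (Gp *: (Gm *: v))).
Proof. exact: verma_singular_vectors. Qed.
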